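(* Let $\xi\in\mathbb{R}$ be such that $1,\xi,\xi^3$ are linearly independent over $\mathbb{Q}$, let $\lambda,c>0$ be such that for each sufficiently large real number $X$ there exists a non-zero point $\mathbf{x}\in\mathbb{Z}^3$ with $\|\mathbf{x}\|\le X$ and $L(\mathbf{x})\le cX^{-\lambda}$, and let $(\mathbf{x}_i)_{i\ge1}$ be a sequence of minimal points for $(1,\xi,\xi^3)$. Suppose that $\lambda>(5-\sqrt{13})/2\cong0.697$. Then $D^{(3)}_i\ne0$ and $D^{(6)}_i\ne0$ for each sufficiently large $i\in I$.
   Context: For $\mathbf{x}=(x_0,x_1,x_2)\in\mathbb{R}^3$, put $\|\mathbf{x}\|=\max\{|x_0|,|x_1|,|x_2|\}$ and $L(\mathbf{x})=\max\{|x_1-x_0\xi|,|x_2-x_0\xi^3|\}$. A sequence of minimal points for $(1,\xi,\xi^3)$ is a sequence $(\mathbf{x}_i)_{i\ge1}$ of non-zero points of $\mathbb{Z}^3$ such that, with $X_i=\|\mathbf{x}_i\|$ and $L_i=L(\mathbf{x}_i)$: (a) $X_1<X_2<X_3<\cdots$; (b) $1/2>L_1>L_2>L_3>\cdots$; (c) if $L(\mathbf{x})<L_i$ for some $\mathbf{x}\in\mathbb{Z}^3\setminus\{0\}$ and some $i\ge1$, then $\|\mathbf{x}\|\ge X_{i+1}$. $I$ is the set of integers $i\ge2$ such that $\mathbf{x}_{i-1},\mathbf{x}_i,\mathbf{x}_{i+1}$ are linearly independent; it is an infinite set, ordered increasingly. For triples of indeterminates $\mathbf{x},\mathbf{y},\mathbf{z}$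 put $\varphi(\mathbf{x})=x_0^2x_2-x_1^3$ and $\Phi(\mathbf{x},\mathbf{y},\mathbf{z})=x_0y_0z_2+x_0y_2z_0+x_2y_0z_0-3x_1y_1z_1$, and $$S=\varphi(\mathbf{x}),\quad T=\Phi(\mathbf{x},\mathbf{x},\mathbf{y}),\quad U=\Phi(\mathbf{x},\mathbf{y},\mathbf{y}),\quad V=\varphi(\mathbf{y}),\quad F=T^2-4SU,$$ $$D^{(3)}=F^3-18TF(S^2V)-135(S^2V)^2,$$ $$D^{(6)}=TF^4+10F^3(S^2V)-11T^2F^2(S^2V)-180TF(S^2V)^2-T^3(S^2V)^2-675(S^2V)^3 .$$ For $i\in I$ with successor $j$ in $I$, $D^{(3)}_i$ and $D^{(6)}_i$ denote the values of $D^{(3)}$ and $D^{(6)}$ at $(\mathbf{x},\mathbf{y})=(\mathbf{x}_i,\mathbf{x}_j)$. *)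

(* Defs.v *)
From HB Require Import structures.
From mathcomp Require Import all_boot all_order all_algebra.
From mathcomp Require Import all_classical all_reals all_analysis.

Set Implicit Arguments.
Unset Strict Implicit.
Unset Printing Implicit Defensive.

Import Order.TTheory GRing.Theory Num.Theory.
Import numFieldNormedType.Exports.

Local Open Scope classical_set_scope.
Local Open Scope ring_scope.

(* A triple (x_0, x_1, x_2) is a row vector x, with x_k written x 0 k. *)

Section Forms.
Variable A : comNzRingType.
Implicit Types x y z : 'rV[A]_3.

Definition phi x : A := x 0 0 ^+ 2 * x 0 2 - x 0 1 ^+ 3.

Definition Phi x y z : A :=
  x 0 0 * y 0 0 * z 0 2 + x 0 0 * y 0 2 * z 0 0 + x 0 2 * y 0 0 * z 0 0
  - 3 * x 0 1 * y 0 1 * z 0 1.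

Definition formS x y : A := phi x.
Definition formT x y : A := Phi x x y.
Definition formU x y : A := Phi x y y.
Definition formV x y : A := phi y.
Definition formF x y : A := formT x y ^+ 2 - 4 * formS x y * formU x y.

Definition D3 x y : A :=
  let T := formT x y in
  let F := formF x y in
  let S2V := formS x y ^+ 2 * formV x y in
  F ^+ 3 - 18 * T * F * S2V - 135 * S2V ^+ 2.

Definition D6 x y : A :=
  let T := formT x y in
  let F := formF x y in
  let S2V := formS x y ^+ 2 * formV x y in
  T * F ^+ 4 + 10 * F ^+ 3 * S2V - 11 * T ^+ 2 * F ^+ 2 * S2V
  - 180 * T * F * S2V ^+ 2 - T ^+ 3 * S2V ^+ 2 - 675 * S2V ^+ 3.

End Forms.

Section MinimalPoints.
Variable R : realType.

Definition supnorm (x : 'rV[R]_3) : R :=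
  Num.max (Num.max `|x 0 0| `|x 0 1|) `|x 0 2|.

Definition Lxi (xi : R) (x : 'rV[R]_3) : R :=
  Num.max `|x 0 1 - x 0 0 * xi| `|x 0 2 - x 0 0 * xi ^+ 3|.

Definition toR (x : 'rV[int]_3) : 'rV[R]_3 := map_mx intr x.

(* Sequences are indexed from 1; the value at 0 is irrelevant. *)
Definition minimal_points (xi : R) (x : nat -> 'rV[int]_3) : Prop :=
  [/\ forall i, (1 <= i)%N -> x i != 0,
      forall i, (1 <= i)%N -> supnorm (toR (x i)) < supnorm (toR (x i.+1)),
      Lxi xi (toR (x 1%N)) < 1 / 2,
      forall i, (1 <= i)%N -> Lxi xi (toR (x i.+1)) < Lxi xi (toR (x i)) &
      forall (y : 'rV[int]_3) i, y != 0 -> (1 <= i)%N ->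
        Lxi xi (toR y) < Lxi xi (toR (x i)) ->
        supnorm (toR (x i.+1)) <= supnorm (toR y)].

Definition lin_indep_rat (a b c : R) : Prop :=
  forall p q r : rat, ratr p * a + ratr q * b + ratr r * c = 0 ->
    [/\ p = 0, q = 0 & r = 0].

End MinimalPoints.

Definition lin_indep_points (x y z : 'rV[int]_3) : bool :=
  row_free (map_mx intr (col_mx x (col_mx y z)) : 'M[rat]_(1 + (1 + 1), 3)).

Definition indexI (x : nat -> 'rV[int]_3) : set nat :=
  [set i | (2 <= i)%N /\ lin_indep_points (x i.-1) (x i) (x i.+1)].

Definition successor_in (I : set nat) (i j : nat) : Prop :=
  [/\ I i, I j, (i < j)%N & forall k, I k -> (i < k)%N -> (j <= k)%N].

(* Main.v *)
Require Import Defs.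
From mathcomp Require Import all_boot all_order all_algebra.
From mathcomp Require Import all_classical all_reals all_analysis.
From mathcomp Require Import ring lra zify.
Import Order.TTheory GRing.Theory Num.Theory.
Import numFieldNormedType.Exports.
Local Open Scope classical_set_scope.
Local Open Scope ring_scope.

(** Fix a large i in I with successor j. Write X, Z, Y, Q for the norms of x_i,
    x_(i+1), x_j, x_(j+1), put L = L_i, M = L_j and s = S^2 V, and suppose that
    D3 or D6 vanishes at (x_i, x_j). The proof confronts an arithmetic
    consequence of this vanishing with estimates for the sizes of T, F and s.

    Geometry of minimal points. Here L << Z^(-lambda), M << Q^(-lambda)
    (approx_log), and the points from x_i to x_j lie in one plane, whose height
    is at most of the order of Z L. That plane meets the one of x_j and x_(j+1)
    along x_j, which is primitive, whence Y << (Z L) (Q M) (successor_height).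
    For the predecessor of i in I the same inequality gives
    X^lambda << Z L. Moreover S and V are non-zero integers, because a primitive
    zero of x0^2 x2 - x1^3 has the form (p^3, p^2 q, q^3) and would be
    proportional to the previous minimal point (phi_zero_bound).

    Sizes. Let del = (x2 - x0 xi^3) - 3 xi^2 (x1 - x0 xi) for the point x_i.
    Expanding the forms, S has the size of X^2 |del| and T that of X Y |del|,
    which is at least Y / X, while |V| << Y^2 M and
    |F| << Y^2 L^4 + X^3 Y L M + X^4 M^2. The geometric inequalities show that
    X^3 Y L M tends to 0, precisely because lambda^2 - 5 lambda + 3 < 0
    (exponent_X3YLM), and that the third term tends to 0 too. So s / T tends to
    0, and F, if it is not 0, satisfies |F| << Y^2 L^4.

    Arithmetic. For integers T, F, s with s non-zero and T much larger than s,
    the vanishing of D3 or D6 implies that F is not 0, that |s T| << F^2 and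
    that |T| << |s|^3 (D3_zero_bounds, D6_zero_bounds). For D3 this is the
    remark that F divides 135 s^2. For D6 the curve D6 = 0 is parametrised
    rationally by a number t close to a square root of 5, and the bound comes
    from the divisibility relations between the numerator and denominator of t
    and the integers T, F, s.

    Conclusion. From |T|^4 << |s T|^3 << F^6 one gets X Y^2 L^6 >> 1, and from
    |T| << |s|^3 one gets X^11 Y^5 L^5 M^3 >> 1. Taking logarithms, these two
    lower bounds contradict the geometric inequalities
    (exponents_contradiction). *)

Set Implicit Arguments.
Unset Strict Implicit.

(** * Integer solutions of D3 = 0 and of D6 = 0 *)

(** The relation reads F^3 = s (18 T F + 135 s). As |T F| is much larger than
    |s|, the bracket has the size of T F, so that F^2 has the size of s T. It
    also shows that F divides 135 s^2; together these give |T| << |s|^3. *)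
Lemma D3_zero_bounds (T F s : int) :
  s != 0 -> 100 * `|s| <= `|T| ->
  F ^+ 3 - 18 * T * F * s - 135 * s ^+ 2 = 0 ->
  [/\ F != 0, `|s| * `|T| <= F ^+ 2 & `|T| <= 135 ^+ 2 * `|s| ^+ 3].
Proof.
move=> s0 Ts E.
have F0 : F != 0.
  apply/eqP => F0; move: E; rewrite F0 => E.
  have : s ^+ 2 = 0 by lia.
  by move/eqP; rewrite sqrf_eq0 (negbTE s0).
have s1 : 1 <= `|s| by rewrite -gtz0_ge1 normr_gt0.
have F1 : 1 <= `|F| by rewrite -gtz0_ge1 normr_gt0.
have EF : F ^+ 3 = s * (18 * (T * F) + 135 * s) by move: E; lia.
have lb : `|T| * `|F| <= `|18 * (T * F) + 135 * s|.
  have h1 : `|135 * s| = 135 * `|s| by rewrite normrM.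
  have h2 : `|18 * (T * F)| = 18 * (`|T| * `|F|) by rewrite !normrM.
  have h3 : `|T| <= `|T| * `|F| by rewrite ler_peMr.
  have h4 := ler_norm (18 * (T * F)); have := lerB_normD (18 * (T * F)) (135 * s).
  lia.
have H1 : `|s| * `|T| <= F ^+ 2.
  have : `|F| ^+ 3 = `|s| * `|18 * (T * F) + 135 * s| by rewrite -normrX EF normrM.
  have : `|s| * (`|T| * `|F|) <= `|s| * `|18 * (T * F) + 135 * s| by rewrite ler_wpM2l.
  move=> h E3; move: h; rewrite -E3 mulrA exprSr ler_pM2r ?normr_gt0 //.
  by rewrite real_normK ?num_real.
split=> //.
(* F divides the non-zero integer 135 s^2. *)
have dF : (`|F| <= 135 * `|s| ^+ 2).
  have : F * (F ^+ 2 - 18 * T * s) = 135 * s ^+ 2 by move: E; lia.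
  move/(congr1 Num.norm); rewrite normrM [in X in _ = X]normrM normrX => <-.
  rewrite ler_peMr // -gtz0_ge1 normr_gt0; apply/eqP => h.
  have : 135 * s ^+ 2 = 0 by rewrite -[RHS](mulr0 F) -h; move: E; lia.
  by move/eqP; rewrite mulf_eq0 /= sqrf_eq0 (negbTE s0).
have h : F ^+ 2 <= (135 * `|s| ^+ 2) ^+ 2.
  by rewrite -[F ^+ 2]real_normK ?num_real // lerXn2r // nnegrE ?normr_ge0 // mulr_ge0 // exprn_ge0.
have := le_trans H1 h.
have -> : (135 * `|s| ^+ 2) ^+ 2 = `|s| * (135 ^+ 2 * `|s| ^+ 3) by ring.
by rewrite ler_pM2l // normr_gt0.
Qed.

(** With r = T F / s and K = T^3 / s, the equation D6 = 0 is quadratic in K,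
    and its discriminant is 125 (r + 9)^3 (r + 5). The curve is therefore
    rational, parametrised by t with t^2 = 5 (r + 9) / (r + 5), which is close
    to 5 because r is large: r = 5 (9 - t^2) / (t^2 - 5) and
    K = 25 (3 - t)^3 (t + 1) / (t^2 - 5)^2. *)
Lemma D6_zero_param (K : realFieldType) (T F s : K) :
  s != 0 -> 100 * `|s| <= `|T| -> 1 <= `|F| ->
  T * F ^+ 4 + 10 * F ^+ 3 * s - 11 * T ^+ 2 * F ^+ 2 * s
    - 180 * T * F * s ^+ 2 - T ^+ 3 * s ^+ 2 - 675 * s ^+ 3 = 0 ->
  exists t : K, [/\ t ^+ 2 != 5, 4 < t ^+ 2 < 6, T * F * (t ^+ 2 - 5) = 5 * s * (9 - t ^+ 2) &
      T ^+ 3 * (t ^+ 2 - 5) ^+ 2 = 25 * s * (3 - t) ^+ 3 * (t + 1)].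
Proof.
move=> s0 Ts F1 D0.
(* E / s^2 is up to sign the derivative in K of the quadratic, so its square is the discriminant. *)
pose E := 2 * T ^+ 3 * s + 11 * T ^+ 2 * F ^+ 2 + 180 * T * F * s + 675 * s ^+ 2.
pose t := E / (5 * (T * F + 9 * s) * (T * F + 5 * s)); exists t.
have sp : 0 < `|s| by rewrite normr_gt0.
have TF : 100 * `|s| <= `|T * F|.
  by rewrite normrM; apply: le_trans Ts _; rewrite ler_peMr.
have bnd (k : K) : 0 <= k -> k <= 9 -> 90 * `|s| <= `|T * F + k * s|.
  move=> k0 k9; have := lerB_normD (T * F) (k * s).
  rewrite (normrM k) (ger0_norm k0).
  have : k * `|s| <= 9 * `|s| by rewrite ler_wpM2r.
  lra.
have Qn : T * F + 5 * s != 0 by rewrite -normr_gt0; have := bnd 5 (ler0n _ 5) ltac:(lra); lra.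
have Pn : T * F + 9 * s != 0 by rewrite -normr_gt0; have := bnd 9 (ler0n _ 9) (lexx 9); lra.
have tPQ : t * (5 * (T * F + 9 * s) * (T * F + 5 * s)) = E.
  by rewrite /t divfK // !mulf_neq0 // pnatr_eq0.
have E2 : E ^+ 2 = 125 * (T * F + 9 * s) ^+ 3 * (T * F + 5 * s).
  by apply/eqP; rewrite -subr_eq0; apply/eqP; rewrite -[RHS](mulr0 (- 4 * T ^+ 3)) -D0 /E; ring.
have tQ : t ^+ 2 * (T * F + 5 * s) = 5 * (T * F + 9 * s).
  have n0 : 25 * (T * F + 9 * s) ^+ 2 * (T * F + 5 * s) != 0.
    by rewrite !mulf_neq0 ?expf_neq0 // pnatr_eq0.
  apply: (mulIf n0); rewrite [RHS](_ : _ = 125 * (T * F + 9 * s) ^+ 3 * (T * F + 5 * s)); last by ring.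
  by rewrite -E2 -tPQ; ring.
have Qw : (T * F + 5 * s) * (t ^+ 2 - 5) = 20 * s by rewrite mulrBr mulrC tQ; ring.
have w0 : t ^+ 2 - 5 != 0.
  by apply/eqP => w0; move: Qw; rewrite w0 mulr0 => /esym/eqP; rewrite mulf_eq0 (negbTE s0) pnatr_eq0.
have TFw : T * F * (t ^+ 2 - 5) = 5 * s * (9 - t ^+ 2).
  have -> : T * F * (t ^+ 2 - 5) = (T * F + 5 * s) * (t ^+ 2 - 5) - 5 * s * (t ^+ 2 - 5) by ring.
  by rewrite Qw; ring.
split=> //.
- by rewrite -subr_eq0.
- have : `|t ^+ 2 - 5| < 1.
    have h := bnd 5 (ler0n _ 5) ltac:(lra).
    rewrite -(ltr_pM2l (_ : 0 < `|T * F + 5 * s|)) ?normr_gt0 // -normrM Qw normrM mulr1.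
    by rewrite ger0_norm ?ler0n //; lra.
  by rewrite ltr_norml; lra.
have Pw : (T * F + 9 * s) * (t ^+ 2 - 5) = 4 * t ^+ 2 * s.
  have -> : (T * F + 9 * s) * (t ^+ 2 - 5) = T * F * (t ^+ 2 - 5) + 9 * s * (t ^+ 2 - 5) by ring.
  by rewrite TFw; ring.
have Ew : E * (t ^+ 2 - 5) ^+ 2 = 400 * t ^+ 3 * s ^+ 2.
  have -> : E * (t ^+ 2 - 5) ^+ 2
     = 5 * t * ((T * F + 9 * s) * (t ^+ 2 - 5)) * ((T * F + 5 * s) * (t ^+ 2 - 5)).
    by rewrite -tPQ; ring.
  by rewrite Pw Qw; ring.
have s2 : 2 * s != 0 by rewrite mulf_neq0 // pnatr_eq0.
apply: (mulfI s2).
have -> : 2 * s * (T ^+ 3 * (t ^+ 2 - 5) ^+ 2) = E * (t ^+ 2 - 5) ^+ 2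
   - 11 * (T * F * (t ^+ 2 - 5)) ^+ 2 - 180 * s * (T * F * (t ^+ 2 - 5)) * (t ^+ 2 - 5)
   - 675 * s ^+ 2 * (t ^+ 2 - 5) ^+ 2 by rewrite /E; ring.
by rewrite Ew TFw; ring.
Qed.

(** The parametrisation with denominators cleared, for t = m / n. *)
Lemma D6_param_int (K : realFieldType) (T F s m n : int) (t : K) :
  0 < n -> t * n%:~R = m%:~R -> t ^+ 2 != 5 -> 4 < t ^+ 2 < 6 ->
  T%:~R * F%:~R * (t ^+ 2 - 5) = 5 * s%:~R * (9 - t ^+ 2) ->
  T%:~R ^+ 3 * (t ^+ 2 - 5) ^+ 2 = 25 * s%:~R * (3 - t) ^+ 3 * (t + 1) ->
  let N := m ^+ 2 - 5 * n ^+ 2 in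
  [/\ N != 0, 4 * n ^+ 2 < m ^+ 2 < 6 * n ^+ 2,
      T * F * N = 5 * s * (3 * n - m) * (3 * n + m) &
      T ^+ 3 * N ^+ 2 = 25 * s * (3 * n - m) ^+ 3 * (m + n)].
Proof.
move=> np tn t5 /andP[tl tu] e1 e2 N.
have n0 : (n%:~R : K) != 0 by rewrite intr_eq0 gt_eqF.
have np2 : 0 < (n%:~R : K) ^+ 2 by rewrite exprn_gt0 // ltr0z.
have qm2 : (m ^+ 2)%:~R = t ^+ 2 * n%:~R ^+ 2 :> K by rewrite -exprMn tn; ring.
have qN : N%:~R = (t ^+ 2 - 5) * n%:~R ^+ 2 :> K by rewrite /N intrD qm2; ring.
split.
- by rewrite -(intr_eq0 K) qN mulf_neq0 ?subr_eq0 // expf_neq0.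
- by apply/andP; split; rewrite -(ltr_int K) qm2 intrM rmorphXn /= ltr_pM2r.
- apply: (@intr_inj K).
  have -> : (T * F * N)%:~R = (T%:~R * F%:~R * (t ^+ 2 - 5)) * n%:~R ^+ 2 :> K.
    by rewrite !intrM qN; ring.
  rewrite e1.
  have -> : (5 * s * (3 * n - m) * (3 * n + m))%:~R
     = 5 * s%:~R * (3 * n%:~R - m%:~R) * (3 * n%:~R + m%:~R) :> K by ring.
  by rewrite -tn; ring.
- apply: (@intr_inj K).
  have -> : (T ^+ 3 * N ^+ 2)%:~R = (T%:~R ^+ 3 * (t ^+ 2 - 5) ^+ 2) * n%:~R ^+ 4 :> K.
    by rewrite intrM !rmorphXn /= qN; ring.
  rewrite e2.
  have -> : (25 * s * (3 * n - m) ^+ 3 * (m + n))%:~R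
     = 25 * s%:~R * (3 * n%:~R - m%:~R) ^+ 3 * (m%:~R + n%:~R) :> K by ring.
  by rewrite -tn; ring.
Qed.

Lemma D6_cast (K : comNzRingType) (T F s : int) :
  (T * F ^+ 4 + 10 * F ^+ 3 * s - 11 * T ^+ 2 * F ^+ 2 * s
    - 180 * T * F * s ^+ 2 - T ^+ 3 * s ^+ 2 - 675 * s ^+ 3)%:~R =
  T%:~R * F%:~R ^+ 4 + 10 * F%:~R ^+ 3 * s%:~R - 11 * T%:~R ^+ 2 * F%:~R ^+ 2 * s%:~R
    - 180 * T%:~R * F%:~R * s%:~R ^+ 2 - T%:~R ^+ 3 * s%:~R ^+ 2 - 675 * s%:~R ^+ 3 :> K.
Proof. ring. Qed.

(** Integer form of the parametrisation, obtained by writing the rational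
    number t in lowest terms. *)
Lemma D6_zero_int_param (T F s : int) :
  s != 0 -> 100 * `|s| <= `|T| -> 1 <= `|F| ->
  T * F ^+ 4 + 10 * F ^+ 3 * s - 11 * T ^+ 2 * F ^+ 2 * s
    - 180 * T * F * s ^+ 2 - T ^+ 3 * s ^+ 2 - 675 * s ^+ 3 = 0 ->
  exists m n : int, let N := m ^+ 2 - 5 * n ^+ 2 in
  [/\ 0 < n, coprimez m n, N != 0 & [/\ 4 * n ^+ 2 < m ^+ 2 < 6 * n ^+ 2,
      T * F * N = 5 * s * (3 * n - m) * (3 * n + m) &
      T ^+ 3 * N ^+ 2 = 25 * s * (3 * n - m) ^+ 3 * (m + n)]].
Proof.
move=> s0 Ts F1 D0.
have qs0 : s%:~R != 0 :> rat by rewrite intr_eq0.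
have qTs : 100 * `|s%:~R| <= `|T%:~R| :> rat.
  by rewrite -!intr_norm -[100]/(100%:~R) -intrM ler_int.
have qF1 : 1 <= `|F%:~R| :> rat by rewrite -intr_norm -[1]/(1%:~R) ler_int.
have qD0 := congr1 (fun z : int => z%:~R : rat) D0.
rewrite D6_cast in qD0.
have [t [t5 tb e1 e2]] := D6_zero_param qs0 qTs qF1 qD0.
have tn : t * (denq t)%:~R = (numq t)%:~R.
  by rewrite numqE.
have [N0 b i1 i2] := D6_param_int (denq_gt0 t) tn t5 tb e1 e2.
have cmn : coprimez (numq t) (denq t).
  by rewrite /coprimez /gcdz; have := coprime_num_den t; rewrite /coprime => /eqP ->.
by exists (numq t), (denq t); exact: (And4 (denq_gt0 t) cmn N0 (And3 b i1 i2)).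
Qed.

Lemma coprime_reduction (u v : int) : v != 0 ->
  exists g a b : int, [/\ 0 < g, u = a * g, v = b * g & coprimez a b].
Proof.
move=> v0; exists (gcdz u v), (u %/ gcdz u v)%Z, (v %/ gcdz u v)%Z.
have g0 : gcdz u v != 0 by rewrite gcdz_eq0 (negbTE v0) andbF.
have eu := divzK (dvdz_gcdl u v); have ev := divzK (dvdz_gcdr u v).
have gp : 0 < gcdz u v by rewrite lt_def g0.
split=> //.
have h := mulz_gcdl (u %/ gcdz u v)%Z (v %/ gcdz u v)%Z (gcdz u v).
rewrite eu ev abszE (gtr0_norm gp) in h.
by rewrite /coprimez -(inj_eq (mulIf g0)) h mul1r.
Qed.

(** The conclusion of D3_zero_bounds for the other polynomial. Let t = m / n be
    the parameter in lowest terms, N = m^2 - 5 n^2 and c = T / (3 n - m). Then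
    25 s (m + n) = N^2 c^3 and 5 F (m + n) = (3 n + m) N c^2. The first relation
    forces the denominator b of c to divide 16, and then, up to constants, the
    second one forces m + n to divide c^2. Hence |n| << c^2, and from this
    |c| << |s| and |T| << |n c| << |c|^3 << |s|^3. *)
Lemma D6_zero_bounds (T F s : int) :
  s != 0 -> 100 * `|s| <= `|T| ->
  T * F ^+ 4 + 10 * F ^+ 3 * s - 11 * T ^+ 2 * F ^+ 2 * s
    - 180 * T * F * s ^+ 2 - T ^+ 3 * s ^+ 2 - 675 * s ^+ 3 = 0 ->
  [/\ F != 0, `|s| * `|T| <= 100 * F ^+ 2 &
      `|T| <= 40 * (200 * 16 ^+ 3) ^+ 3 * `|s| ^+ 3].
Proof.
move=> s0 Ts D0.
have s1 : 1 <= `|s| by rewrite -gtz0_ge1 normr_gt0.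
have T100 : 100 <= `|T| by apply: le_trans Ts; rewrite ler_peMr.
have T0 : T != 0 by rewrite -normr_gt0; apply: lt_le_trans T100.
have F0 : F != 0.
  apply/eqP => F0; move: D0; rewrite F0 => D0.
  have : s ^+ 2 * (T ^+ 3 + 675 * s) = 0 by rewrite -[RHS]oppr0 -D0; ring.
  move/eqP; rewrite mulf_eq0 sqrf_eq0 (negbTE s0) /= => /eqP h.
  have h3 : `|T| ^+ 3 = 675 * `|s|.
    by rewrite -normrX (_ : T ^+ 3 = - (675 * s)) ?normrN ?normrM //; apply/eqP; rewrite -addr_eq0; apply/eqP.
  have : `|T| * 100 <= `|T| ^+ 3.
    rewrite exprS ler_wpM2l // (le_trans T100) // ler_eXnr //.
    by apply: le_trans T100.
  by rewrite h3; move: Ts s1; clear; lia.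
have F1 : 1 <= `|F| by rewrite -gtz0_ge1 normr_gt0.
have [m [n [np cmn N0 [/andP[ml mu] i1 i2]]]] := D6_zero_int_param s0 Ts F1 D0.
set N := (X in X != 0) in N0; rewrite -/N in i1 i2.
have mc : (2 * n < m /\ 2 * m < 5 * n) \/ (m < - 2 * n /\ -5 * n < 2 * m).
  move: (m) (n) ml mu np; clear => m n *; nia.
clear ml mu.
have k0 : 3 * n - m != 0 by apply/eqP; move: mc np; clear; lia.
have l0 : m + n != 0 by apply/eqP; move: mc np; clear; lia.
(* These inequalities only express that m / n is close to 5^(1/2) or to - 5^(1/2). *)
have kl : `|3 * n - m| <= 5 * `|m + n| by move: mc np; clear; lia.
have kk : 25 * (`|3 * n - m| * `|m + n|) <= 900 * (3 * n + m) ^+ 2.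
  by move: (m) (n) mc np; clear => m n *; nia.
have h0 : 3 * n + m != 0 by apply/eqP; move: mc np; clear; lia.
have sTF : `|s| * `|T| <= 100 * F ^+ 2.
  have e : s * T * (3 * n + m) ^+ 2 = F ^+ 2 * ((3 * n - m) * (m + n)).
    have w0 : 25 * (T * N) ^+ 2 != 0 by rewrite mulf_neq0 // expf_neq0 // mulf_neq0.
    apply: (mulIf w0).
    have -> : F ^+ 2 * ((3 * n - m) * (m + n)) * (25 * (T * N) ^+ 2)
      = 25 * (3 * n - m) * (m + n) * (T * F * N) ^+ 2 by ring.
    have -> : s * T * (3 * n + m) ^+ 2 * (25 * (T * N) ^+ 2)
      = 25 * s * (3 * n + m) ^+ 2 * (T ^+ 3 * N ^+ 2) by ring.
    by rewrite i1 i2; ring.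
  have h2 : 0 < (3 * n + m) ^+ 2 by rewrite exprn_even_gt0.
  have ee : `|s| * `|T| * (3 * n + m) ^+ 2 = F ^+ 2 * (`|3 * n - m| * `|m + n|).
    rewrite -!normrM -[in LHS](ger0_norm (ltW h2)) -[in RHS](ger0_norm (sqr_ge0 F)).
    by rewrite -!normrM e.
  have fk := ler_wpM2l (sqr_ge0 F) kk.
  rewrite -(ler_pM2r h2) ee; move: (mulr_ge0 (sqr_ge0 F) (ltW h2)) fk; rewrite -normrM.
  move: (F ^+ 2) ((3 * n + m) ^+ 2) `|_| => A B C; clear; lia.
split=> //.
have [g [a [b [g0 Ta kb cab]]]] := coprime_reduction T k0.
have b0 : b != 0 by apply/eqP => b0; move: k0; rewrite kb b0 mul0r eqxx.
have ab : a * (3 * n - m) = b * T by rewrite Ta kb; ring.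
have i3 : a ^+ 3 * N ^+ 2 = 25 * s * (m + n) * b ^+ 3.
  have k3 : (3 * n - m) ^+ 3 != 0 by rewrite expf_neq0.
  apply: (mulIf k3).
  have -> : a ^+ 3 * N ^+ 2 * (3 * n - m) ^+ 3 = (a * (3 * n - m)) ^+ 3 * N ^+ 2 by ring.
  have -> : (a * (3 * n - m)) ^+ 3 * N ^+ 2 = b ^+ 3 * (T ^+ 3 * N ^+ 2) by rewrite ab; ring.
  by rewrite i2; ring.
have a0 : a != 0 by apply/eqP => a0; move: T0; rewrite Ta a0 mul0r eqxx.
have i4 : 5 * F * (m + n) * b ^+ 2 = a ^+ 2 * N * (3 * n + m).
  have z0 : T * N * (b * b ^+ 3) != 0 by rewrite !mulf_neq0 ?expf_neq0.
  apply: (mulIf z0).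
  have -> : 5 * F * (m + n) * b ^+ 2 * (T * N * (b * b ^+ 3))
    = 5 * b ^+ 3 * (m + n) * b ^+ 3 * (T * F * N) by ring.
  rewrite i1.
  have -> : 5 * b ^+ 3 * (m + n) * b ^+ 3 * (5 * s * (3 * n - m) * (3 * n + m))
   = b ^+ 3 * (3 * n - m) * (3 * n + m) * (25 * s * (m + n) * b ^+ 3) by ring.
  rewrite -i3.
  have -> : b ^+ 3 * (3 * n - m) * (3 * n + m) * (a ^+ 3 * N ^+ 2)
   = b ^+ 3 * a ^+ 2 * (3 * n + m) * N ^+ 2 * (a * (3 * n - m)) by ring.
  by rewrite ab; ring.
have bk : (b %| 3 * n - m)%Z by rewrite kb dvdz_mulr.
have cbn : coprimez b n.
  have [[u v] /= uv] := coprimezP _ _ cmn.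
  apply/coprimezP; exists (u * -g, v + 3 * u) => /=.
  rewrite -[RHS]uv (_ : u * - g * b = - u * (3 * n - m)); first by ring.
  by rewrite kb; ring.
(* Modulo b one has m = 3 n, hence N = 4 n^2, while b divides N^2 and is prime to n. *)
have b16 : (b %| 16)%Z.
  have cb4 : coprimez b (n ^+ 4) by rewrite coprimezXr.
  rewrite -(Gauss_dvdzl _ cb4).
  have -> : 16 * n ^+ 4 = (3 * n - m) * ((3 * n + m) * (4 * n ^+ 2 + N)) + N ^+ 2.
    by rewrite /N; ring.
  apply: rpredD; first exact: dvdz_mulr.
  have c3 : coprimez b (a ^+ 3) by rewrite coprimezXr // coprimez_sym.
  rewrite -(Gauss_dvdzr (N ^+ 2) c3) i3 [b ^+ 3]exprS.
  by rewrite dvdz_mull // dvdz_mulr.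
(* Modulo m + n one has (3 n + m) N = - 8 n^3, and m + n is prime to n. *)
have mn8 : (m + n %| 8 * a ^+ 2)%Z.
  have cmn3 : coprimez (m + n) (n ^+ 3).
    apply: coprimezXr; have [[u v] /= uv] := coprimezP _ _ cmn.
    by apply/coprimezP; exists (u, v - u) => /=; rewrite -[RHS]uv; ring.
  rewrite -(Gauss_dvdzl _ cmn3).
  have -> : 8 * a ^+ 2 * n ^+ 3 = (m + n) * (a ^+ 2 * (m ^+ 2 + 2 * m * n - 7 * n ^+ 2 + 1 * 0)
      ) - a ^+ 2 * N * (3 * n + m) by rewrite /N; ring.
  rewrite -i4; apply: rpredB; first exact: dvdz_mulr.
  by apply: dvdz_mulr; apply: dvdz_mull.
have b16' : `|b| <= 16.
  have := dvdn_leq (ltn0Sn 15) b16; clear; lia.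
have mn8' : `|m + n| <= 8 * `|a| ^+ 2.
  have ap : 0 < `|a| ^+ 2 by rewrite exprn_gt0 // normr_gt0.
  move: mn8 => /dvdzP [w ew].
  have : 8 * `|a| ^+ 2 = `|w| * `|m + n| by rewrite -normrM -ew normrM normrX.
  move=> e; rewrite e ler_peMl // -gtz0_ge1 normr_gt0.
  apply/eqP => w0; have := mulr_gt0 (ltr0Sn int 7) ap.
  by rewrite e w0 normr0 mul0r ltxx.
have bp : 1 <= `|b| by rewrite -gtz0_ge1 normr_gt0.
have ap : 0 < `|a| ^+ 2 by rewrite exprn_gt0 // normr_gt0.
have b3 : `|b| ^+ 3 <= 16 ^+ 3 by rewrite lerXn2r // nnegrE.
have as_ : `|a| <= 200 * 16 ^+ 3 * `|s|.
  rewrite -(ler_pM2l ap).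
  have N1 : 1 <= `|N| ^+ 2 by rewrite exprn_ege1 // -gtz0_ge1 normr_gt0.
  have h1 : `|a| ^+ 3 * `|N| ^+ 2 = 25 * `|s| * `|m + n| * `|b| ^+ 3.
    by rewrite -(normrX 3 a) -(normrX 2 N) -normrM i3 normrM (normrX 3 b) 2!normrM.
  have h2 : 25 * `|s| * `|m + n| <= 200 * `|s| * `|a| ^+ 2.
    have : `|s| * `|m + n| <= `|s| * (8 * `|a| ^+ 2) by rewrite ler_wpM2l.
    by clear; lia.
  have h3 := ler_pM (mulr_ge0 (mulr_ge0 (ler0n _ 25) (normr_ge0 s)) (normr_ge0 _))
    (exprn_ge0 3 (normr_ge0 b)) h2 b3.
  rewrite -exprSr; apply: (@le_trans _ _ (`|a| ^+ 3 * `|N| ^+ 2)).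
    by rewrite ler_peMr // exprn_ge0.
  rewrite h1; apply: le_trans h3 _.
  by rewrite le_eqVlt; apply/orP; left; apply/eqP; ring.
have Ta3 : `|T| <= 40 * `|a| ^+ 3.
  have h1 : `|T| <= `|a| * `|3 * n - m|.
    by rewrite -normrM ab normrM ler_peMl.
  have h2 : `|a| * `|3 * n - m| <= `|a| * (40 * `|a| ^+ 2).
    by rewrite ler_wpM2l //; move: kl mn8'; clear; lia.
  apply: le_trans h1 (le_trans h2 _).
  by rewrite le_eqVlt; apply/orP; left; apply/eqP; ring.
apply: le_trans Ta3 _; rewrite -mulrA -exprMn ler_pM2l // lerXn2r // nnegrE.
Qed.

(** * Sizes of the forms at two points close to the line *)

Lemma abs_sum10_le (R : realFieldType) (a1 a2 a3 a4 a5 a6 a7 a8 a9 a10 u v p q z : R) :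
  `|a1| <= 9 * q -> `|a2| <= 4 * q -> `|a3| <= 4 * p -> `|a4| <= 36 * p ->
  `|a5| <= 6 * p -> `|a6| <= 54 * p -> `|a7| <= 48 * p -> `|a8| <= 32 * p ->
  `|a9| <= 192 * p -> a10 <= 2 * u + 2 * v -> u <= z -> v <= 81 * p ->
  0 <= p -> 0 <= q -> 0 <= z -> 0 <= a10 ->
  `|a1 + a2 - a3 - a4 - a5 + a6 + a7 + a8 - a9 + a10| <= 600 * q + 600 * p + 600 * z.
Proof.
rewrite !ler_norml => /andP[? ?] /andP[? ?] /andP[? ?] /andP[? ?] /andP[? ?] /andP[? ?].
by move=> /andP[? ?] /andP[? ?] /andP[? ?] *; apply/andP; split; lra.
Qed.

(** A point is described by its first coordinate x0 and by the small numbers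
    d = x1 - x0 xi and del = (x2 - x0 xi^3) - 3 xi^2 d, in terms of which
    phi = x0^2 del - 3 xi x0 d^2 - d^3. The second point has coordinates
    y0, e, eps. The letters sigma, tau and upsilon collect terms of S, T and U
    of higher order in the small numbers, X and Y bound the first coordinates,
    and L and M bound the small ones. *)
Section Est.
Variables (R : realFieldType) (xi k : R).
Hypotheses (k1 : 1 <= k) (xik : `|xi| <= k).
Variables (x0 d del y0 e eps X L Y M : R).
Hypotheses (X1 : 1 <= X) (XY : X <= Y) (L0 : 0 < L) (L1 : L <= 1) (M0 : 0 < M) (ML : M <= L).
Hypotheses (x0X : `|x0| <= X) (dL : `|d| <= L) (delL : `|del| <= k * L).
Hypotheses (y0Y : `|y0| <= Y) (eM : `|e| <= M) (epsM : `|eps| <= k * M).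

Let sigma := 3 * xi * x0 * (d * d) + d * d * d.
Let tau := 6 * xi * x0 * d * e + 3 * d * d * e.
Let upsilon := 3 * xi * (x0 * (e * e) + 2 * y0 * d * e) + 3 * d * (e * e).
Let S := x0 ^+ 2 * del - sigma.
Let T := 2 * x0 * y0 * del - 3 * xi * y0 * (d * d) + x0 ^+ 2 * eps - tau.
Let U := y0 ^+ 2 * del + 2 * x0 * y0 * eps - upsilon.

Let k0 : 0 < k. Proof. exact: lt_le_trans ltr01 k1. Qed.
Let X0 : 0 < X. Proof. exact: lt_le_trans ltr01 X1. Qed.
Let Y1 : 1 <= Y. Proof. exact: le_trans X1 XY. Qed.
Let Y0 : 0 < Y. Proof. exact: lt_le_trans ltr01 Y1. Qed.
Let LX : L <= X. Proof. exact: le_trans L1 X1. Qed.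

(* pos proves that a product of numbers known to be non-negative is non-negative;
   pm compares two products factor by factor. *)
Ltac pos := repeat match goal with
  | |- is_true (0 <= _ * _) => apply: mulr_ge0
  | |- is_true (0 <= `|_|) => exact: normr_ge0
  | |- is_true (0 <= _) => first [exact: ler0n | exact: ltW]
  end.
Ltac pm := repeat match goal with
  | |- is_true (_ * _ <= _ * _) => apply: ler_pM
  | |- is_true (0 <= _) => pos
  | |- is_true (`|1| <= _) => rewrite normr1
  | |- is_true (`|_%:R| <= _) => rewrite ger0_norm ?ler0n //
  end; try done.

Lemma sigma_bound : `|sigma| <= 4 * k * X * (L * L).
Proof.
have h1 : `|3 * xi * x0 * (d * d)| <= 3 * k * X * (L * L) by rewrite !normrM; pm.
have h2 : `|d * d * d| <= k * X * (L * L).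
  have -> : d * d * d = 1 * d * (d * d) by ring.
  by rewrite !normrM normr1; pm; exact: le_trans dL LX.
by apply: le_trans (ler_normD _ _) _; lra.
Qed.

Lemma tau_bound : `|tau| <= 9 * k * X * L * M.
Proof.
have h1 : `|6 * xi * x0 * d * e| <= 6 * k * X * L * M by rewrite !normrM; pm.
have h2 : `|3 * 1 * d * d * e| <= 3 * k * X * L * M.
  by rewrite !normrM; pm; exact: le_trans dL LX.
apply: le_trans (ler_normD _ _) _; move: h1 h2; rewrite mulr1; lra.
Qed.

Lemma upsilon_bound : `|upsilon| <= 12 * k * Y * L * M.
Proof.
have h1 : `|3 * xi * x0 * e * e| <= 3 * k * Y * L * M.
  by rewrite !normrM; pm; [exact: le_trans XY | exact: le_trans eM ML].
have h2 : `|6 * xi * y0 * d * e| <= 6 * k * Y * L * M by rewrite !normrM; pm.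
have h3 : `|3 * 1 * e * d * e| <= 3 * k * Y * L * M.
  rewrite !normrM; pm.
  exact: le_trans (le_trans eM ML) (le_trans L1 Y1).
have -> : upsilon = 3 * xi * x0 * e * e + 6 * xi * y0 * d * e + 3 * 1 * e * d * e.
  by rewrite /upsilon; ring.
apply: le_trans (ler_normD _ _) _; have := ler_normD (3 * xi * x0 * e * e) (6 * xi * y0 * d * e).
lra.
Qed.

(** The terms of orders 2 and 3 in d and del that are free of e and eps cancel:
    what is left is y0^2 d^3 (9 xi^2 d + 4 del), together with terms that are
    linear or quadratic in the smaller quantities e and eps. *)
Lemma F_eq : T ^+ 2 - 4 * S * U =
  9 * xi * xi * (y0 * y0) * (d * d * d * d) + 4 * 1 * del * (y0 * y0) * (d * d * d)
  - 4 * 1 * del * eps * y0 * (x0 * x0 * x0) - 4 * x0 * y0 * del * tau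
  - 6 * xi * y0 * (d * d) * (x0 * x0) * eps + 6 * xi * y0 * (d * d) * tau
  + 4 * (x0 * x0) * del * upsilon + 8 * sigma * x0 * y0 * eps - 4 * sigma * upsilon
  + (x0 * x0 * eps - tau) ^+ 2.
Proof. rewrite /T /S /U /sigma; ring. Qed.

(** Each term of F_eq is bounded by one of the three monomials on the right. *)
Lemma F_bound : `|T ^+ 2 - 4 * S * U| <=
  600 * (k * k) * (Y ^+ 2 * L ^+ 4 + X ^+ 3 * Y * L * M + X ^+ 4 * M ^+ 2).
Proof.
pose P := X ^+ 3 * Y * L * M.
pose Q := Y ^+ 2 * L ^+ 4.
have Mone : M <= 1 by exact: le_trans ML L1.
have delX : `|del| <= k * X by apply: le_trans delL _; rewrite ler_pM2l.
have sXL : `|sigma| <= 4 * k * X * L.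
  by apply: le_trans sigma_bound _; rewrite mulrA ler_piMr // ?mulr_ge0 // ltW.
have dXL : `|d * d| <= X * L by rewrite normrM; pm; exact: le_trans dL LX.
have dXX : `|d * d| <= X * X by rewrite normrM; pm; exact: le_trans dL LX.
have tb := tau_bound; have ub := upsilon_bound.
have xx : `|x0 * x0| <= X * X by rewrite normrM; pm.
have yy : `|y0 * y0| <= Y * Y by rewrite normrM; pm.
have t1 : `|9 * xi * xi * (y0 * y0) * (d * d * d * d)| <= 9 * k * k * (Y * Y) * (L * L * L * L).
  by rewrite !normrM; pm.
have t2 : `|4 * 1 * del * (y0 * y0) * (d * d * d)| <= 4 * k * (k * L) * (Y * Y) * (L * L * L).
  by rewrite !normrM normr1; pm.
have t3 : `|4 * 1 * del * eps * y0 * (x0 * x0 * x0)| <= 4 * 1 * (k * L) * (k * M) * Y * (X * X * X).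
  by rewrite !normrM normr1; pm.
have t4 : `|4 * x0 * y0 * del * tau| <= 4 * X * Y * (k * X) * (9 * k * X * L * M).
  by rewrite (normrM _ tau) 3!normrM; pm.
have t5 : `|6 * xi * y0 * (d * d) * (x0 * x0) * eps| <= 6 * k * Y * (X * L) * (X * X) * (k * M).
  by rewrite (normrM _ eps) (normrM _ (x0 * x0)) (normrM _ (d * d)) 2!normrM; pm.
have t6 : `|6 * xi * y0 * (d * d) * tau| <= 6 * k * Y * (X * X) * (9 * k * X * L * M).
  by rewrite (normrM _ tau) (normrM _ (d * d)) 2!normrM; pm.
have t7 : `|4 * (x0 * x0) * del * upsilon| <= 4 * (X * X) * (k * X) * (12 * k * Y * L * M).
  by rewrite (normrM _ upsilon) (normrM _ del) (normrM _ (x0 * x0)); pm.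
have t8 : `|8 * sigma * x0 * y0 * eps| <= 8 * (4 * k * X * L) * X * Y * (k * M).
  by rewrite 3!normrM (normrM _ sigma); pm.
have t8' : 8 * (4 * k * X * L) * X * Y * (k * M) <= 32 * (k * k * P).
  have -> : 8 * (4 * k * X * L) * X * Y * (k * M) = 32 * (k * k) * (X ^+ 2 * Y * L * M) * 1 by ring.
  have -> : 32 * (k * k * P) = 32 * (k * k) * (X ^+ 2 * Y * L * M) * X by rewrite /P; ring.
  by rewrite ler_pM2l // !mulr_gt0 // exprn_gt0.
have t9 : `|4 * sigma * upsilon| <= 4 * (4 * k * X * L) * (12 * k * Y * L * M).
  by rewrite (normrM _ upsilon) (normrM _ sigma); pm.
have t9' : 4 * (4 * k * X * L) * (12 * k * Y * L * M) <= 192 * (k * k * P).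
  have -> : 4 * (4 * k * X * L) * (12 * k * Y * L * M) = 192 * (k * k) * (X * Y * L * M) * (1 * L) by ring.
  have -> : 192 * (k * k * P) = 192 * (k * k) * (X * Y * L * M) * (X * X) by rewrite /P; ring.
  by rewrite ler_pM2l ?mulr_gt0 //; pm.
have t10 : (x0 * x0 * eps - tau) ^+ 2 <= 2 * `|x0 * x0 * eps| ^+ 2 + 2 * `|tau| ^+ 2.
  rewrite !real_normK ?num_real //; move: (x0 * x0 * eps) => a.
  by have := sqr_ge0 (a + tau); rewrite sqrrB sqrrD; lra.
have t11 : `|x0 * x0 * eps| ^+ 2 <= k * k * (X ^+ 4 * M ^+ 2).
  have -> : k * k * (X ^+ 4 * M ^+ 2) = (X * X * (k * M)) ^+ 2 by ring.
  rewrite lerXn2r // ?nnegrE ?normr_ge0 //; first by pos.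
  by rewrite normrM; pm.
have t12 : `|tau| ^+ 2 <= 81 * (k * k * P).
  apply: (@le_trans _ _ ((9 * k * X * L * M) ^+ 2)).
    by rewrite lerXn2r // nnegrE ?normr_ge0 //; pos.
  have -> : (9 * k * X * L * M) ^+ 2 = 81 * (k * k) * (X * X * L * M) * (L * M) by ring.
  have -> : 81 * (k * k * P) = 81 * (k * k) * (X * X * L * M) * (X * Y) by rewrite /P; ring.
  rewrite ler_pM2l ?mulr_gt0 //; pm; exact: le_trans Mone Y1.
have Pp : 0 <= k * k * P by rewrite !mulr_ge0 ?exprn_ge0 //; exact: ltW.
have Qp : 0 <= k * k * Q by rewrite !mulr_ge0 ?exprn_ge0 //; exact: ltW.
have Zp : 0 <= k * k * (X ^+ 4 * M ^+ 2) by rewrite !mulr_ge0 ?exprn_ge0 //; exact: ltW.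
have q1 : 9 * k * k * (Y * Y) * (L * L * L * L) = 9 * (k * k * Q) by rewrite /Q; ring.
have q2 : 4 * k * (k * L) * (Y * Y) * (L * L * L) = 4 * (k * k * Q) by rewrite /Q; ring.
have q3 : 4 * 1 * (k * L) * (k * M) * Y * (X * X * X) = 4 * (k * k * P) by rewrite /P; ring.
have q4 : 4 * X * Y * (k * X) * (9 * k * X * L * M) = 36 * (k * k * P) by rewrite /P; ring.
have q5 : 6 * k * Y * (X * L) * (X * X) * (k * M) = 6 * (k * k * P) by rewrite /P; ring.
have q6 : 6 * k * Y * (X * X) * (9 * k * X * L * M) = 54 * (k * k * P) by rewrite /P; ring.
have q7 : 4 * (X * X) * (k * X) * (12 * k * Y * L * M) = 48 * (k * k * P) by rewrite /P; ring.
rewrite q1 in t1; rewrite q2 in t2; rewrite q3 in t3; rewrite q4 in t4; rewrite q5 in t5.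
rewrite q6 in t6; rewrite q7 in t7.
have {}t8 := le_trans t8 t8'; have {}t9 := le_trans t9 t9'.
have -> : 600 * (k * k) * (Y ^+ 2 * L ^+ 4 + X ^+ 3 * Y * L * M + X ^+ 4 * M ^+ 2)
  = 600 * (k * k * Q) + 600 * (k * k * P) + 600 * (k * k * (X ^+ 4 * M ^+ 2)).
  by rewrite /P /Q; ring.
rewrite F_eq.
exact: (abs_sum10_le t1 t2 t3 t4 t5 t6 t7 t8 t9 t10 t11 t12 Pp Qp Zp (sqr_ge0 _)).
Qed.

Lemma V_bound : `|y0 ^+ 2 * eps - (3 * xi * y0 * (e * e) + e * e * e)| <= 5 * k * Y ^+ 2 * M.
Proof.
have Mone : M <= 1 by exact: le_trans ML L1.
have h1 : `|y0 * y0 * eps| <= Y * Y * (k * M) by rewrite !normrM; pm.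
have h2 : `|3 * xi * y0 * (1 * e * e)| <= 3 * k * Y * (Y * 1 * M).
  by rewrite !normrM; pm; exact: le_trans eM Mone.
have h3 : `|1 * e * e * e| <= k * Y * Y * M.
  by rewrite !normrM; pm; exact: (le_trans eM (le_trans Mone Y1)).
have -> : 5 * k * Y ^+ 2 * M = Y * Y * (k * M) + 3 * k * Y * (Y * 1 * M) + k * Y * Y * M by ring.
have -> : y0 ^+ 2 * eps - (3 * xi * y0 * (e * e) + e * e * e)
  = y0 * y0 * eps - 3 * xi * y0 * (1 * e * e) - 1 * e * e * e by ring.
apply: le_trans (ler_normB _ _) _; rewrite lerD //.
by apply: le_trans (ler_normB _ _) _; rewrite lerD.
Qed.

Section Lower.
Hypotheses (Xx0 : X <= k * `|x0|) (Yy0 : Y <= k * `|y0|) (S1 : 1 <= `|S|).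
Hypotheses (smallL : 100 * (k * k) * (X * (L * L)) <= 1) (smallM : 100 * (k * k) * (X ^+ 3 * M) <= Y).

(** As S is at least 1, its second order part cannot dominate. *)
Lemma S_main : 1 <= 2 * `|x0 ^+ 2 * del| /\ `|S| <= 2 * (X ^+ 2 * `|del|).
Proof.
have hs : `|sigma| <= 1 / 2.
  apply: le_trans sigma_bound _.
  have : k * (X * (L * L)) <= k * k * (X * (L * L)).
    by rewrite -[leLHS]mul1r -[leRHS]mulrA; apply: ler_wpM2r; pos.
  have : 0 <= k * k * (X * (L * L)) by pos.
  move: smallL; lra.
have h1 : `|S| <= `|x0 ^+ 2 * del| + `|sigma| by exact: ler_normB.
have h2 : `|x0 ^+ 2 * del| <= X ^+ 2 * `|del|.
  by rewrite normrM normrX ler_wpM2r // lerXn2r // nnegrE // ltW.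
by split; move: S1; lra.
Qed.

(** The main term of T is 2 x0 y0 del. It is at least of the order of Y / X,
    since x0^2 del is bounded below, and this exceeds the other terms. *)
Lemma T_main : `|x0 * y0 * del| <= `|T|.
Proof.
have [m1 _] := S_main.
have e1 : `|x0 ^+ 2 * del| * `|y0| = `|x0| * `|x0 * y0 * del|.
  by rewrite -!normrM; congr `|_|; ring.
have y00 : 0 <= `|y0| by [].
have b1 : Y <= 2 * k * X * `|x0 * y0 * del|.
  apply: le_trans Yy0 _.
  have g1 : `|y0| <= 2 * (X * `|x0 * y0 * del|).
    have f1 : 1 * `|y0| <= 2 * `|x0 ^+ 2 * del| * `|y0| by rewrite ler_wpM2r.
    have f2 : `|x0| * `|x0 * y0 * del| <= X * `|x0 * y0 * del| by rewrite ler_wpM2r.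
    by move: f1; rewrite -mulrA e1; lra.
  have -> : 2 * k * X * `|x0 * y0 * del| = k * (2 * (X * `|x0 * y0 * del|)) by ring.
  by rewrite ler_pM2l.
have r1 : `|3 * xi * y0 * (d * d)| <= 3 * k * Y * (L * L) by rewrite !normrM; pm.
have r2 : `|x0 * x0 * eps| <= X * X * (k * M) by rewrite !normrM; pm.
have r3 : `|tau| <= 9 * k * X * X * M.
  by apply: le_trans tau_bound _; pm.
pose r := - 3 * xi * y0 * (d * d) + x0 * x0 * eps - tau.
have rb : `|r| <= 3 * k * Y * (L * L) + X * X * (k * M) + 9 * k * X * X * M.
  apply: le_trans (ler_normB _ _) _; rewrite lerD //.
  by apply: le_trans (ler_normD _ _) _; rewrite lerD // !mulNr normrN.
have rX : 2 * k * X * `|r| <= Y.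
  have : 2 * k * X * `|r| <= 2 * k * X * (3 * k * Y * (L * L) + X * X * (k * M) + 9 * k * X * X * M).
    by apply: ler_wpM2l => //; pos.
  have -> : 2 * k * X * (3 * k * Y * (L * L) + X * X * (k * M) + 9 * k * X * X * M)
   = 6 * (Y * (k * k * (X * (L * L)))) + 20 * (k * k * (X ^+ 3 * M)) by ring.
  have : Y * (100 * (k * k) * (X * (L * L))) <= Y * 1 by rewrite ler_pM2l.
  have : 0 <= Y * (k * k * (X * (L * L))) by pos.
  have : 0 <= k * k * (X ^+ 3 * M) by pos; exact: exprn_ge0 (ltW _).
  by move: smallM; lra.
have kX : 0 < 2 * k * X by rewrite !mulr_gt0.
have rl : `|r| <= `|x0 * y0 * del|.
  by rewrite -(ler_pM2l kX); exact: le_trans rX b1.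
have -> : T = 2 * (x0 * y0 * del) - (- r) by rewrite /T /r; ring.
apply: le_trans (lerB_dist _ _); rewrite normrN (normrM 2) (ger0_norm (ler0n _ 2)) //; lra.
Qed.

Lemma T_lower_del : X * Y * `|del| <= k ^+ 2 * `|T|.
Proof.
apply: (@le_trans _ _ (k * `|x0| * (k * `|y0|) * `|del|)); first by pm.
have -> : k * `|x0| * (k * `|y0|) * `|del| = k ^+ 2 * `|x0 * y0 * del|.
  by rewrite !normrM; ring.
by rewrite ler_wpM2l ?exprn_ge0 ?(ltW k0) //; exact: T_main.
Qed.

(** T_lower_del with del eliminated by means of S_main. *)
Lemma T_lower : Y <= 2 * k ^+ 2 * X * `|T|.
Proof.
have [m1 _] := S_main.
have h1 : 1 <= 2 * (X ^+ 2 * `|del|).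
  apply: le_trans m1 _; rewrite ler_pM2l // normrM normrX ler_wpM2r // lerXn2r // nnegrE //.
  exact: ltW.
have h2 := T_lower_del.
have h3 : Y * 1 <= Y * (2 * (X ^+ 2 * `|del|)) by rewrite ler_pM2l.
rewrite mulr1 in h3; apply: le_trans h3 _.
have -> : Y * (2 * (X ^+ 2 * `|del|)) = 2 * X * (X * Y * `|del|) by ring.
have -> : 2 * k ^+ 2 * X * `|T| = 2 * X * (k ^+ 2 * `|T|) by ring.
by rewrite ler_pM2l // mulr_gt0.
Qed.

Let V := y0 ^+ 2 * eps - (3 * xi * y0 * (e * e) + e * e * e).
Let s := S ^+ 2 * V.
Let F := T ^+ 2 - 4 * S * U.

Lemma s_bound : `|s| <= 20 * k * X ^+ 4 * Y ^+ 2 * M * `|del| ^+ 2.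
Proof.
have [_ S2] := S_main.
have h : `|S| ^+ 2 <= (2 * (X ^+ 2 * `|del|)) ^+ 2.
  by rewrite lerXn2r // nnegrE // !mulr_ge0 ?exprn_ge0 // ltW.
have := ler_pM (exprn_ge0 2 (normr_ge0 S)) (normr_ge0 _) h V_bound.
rewrite -normrX -normrM => /le_trans; apply.
by rewrite le_eqVlt; apply/orP; left; apply/eqP; ring.
Qed.

(** The quotient s / T is of the order of X^3 Y |del| M. *)
Lemma s_le_T : 100 * (20 * k ^+ 4 * (X ^+ 3 * Y * L * M)) <= 1 -> 100 * `|s| <= `|T|.
Proof.
move=> sm.
have h1 : `|s| <= 20 * k ^+ 4 * (X ^+ 3 * Y * L * M) * `|T|.
  apply: le_trans s_bound _.
  have -> : 20 * k * X ^+ 4 * Y ^+ 2 * M * `|del| ^+ 2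
    = 20 * k * X ^+ 3 * Y * M * (`|del| * (X * Y * `|del|)) by ring.
  have -> : 20 * k ^+ 4 * (X ^+ 3 * Y * L * M) * `|T|
    = 20 * k * X ^+ 3 * Y * M * ((k * L) * (k ^+ 2 * `|T|)) by ring.
  apply: ler_wpM2l; first by rewrite !mulr_ge0 ?exprn_ge0 // ltW.
  by apply: ler_pM => //; [pos | exact: T_lower_del].
have h2 : 100 * (20 * k ^+ 4 * (X ^+ 3 * Y * L * M)) * `|T| <= 1 * `|T| by rewrite ler_wpM2r.
by move: h1 h2; lra.
Qed.

Variable K0 : R.
Hypotheses (K00 : 0 < K0) (F1 : 1 <= `|F|).
Hypotheses (sTF : `|s| * `|T| <= 100 * F ^+ 2) (Ts3 : `|T| <= K0 * `|s| ^+ 3).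

(** First size condition, X Y^2 L^6 >> 1: from |T|^4 << |s T|^3 << F^6, where F
    has at most the size of Y^2 L^4 because it is a non-zero integer and the
    other terms of F_bound are small, and from |T| >> Y / X. *)
Lemma XY2L6_lower :
  600 * (k * k) * (X ^+ 3 * Y * L * M) <= 1 / 4 -> 600 * (k * k) * (X ^+ 4 * M ^+ 2) <= 1 / 4 ->
  Y ^+ 4 <= (2 * k ^+ 2 * X) ^+ 4 * (K0 * (100 * (12 * 100 * (k * k) * (Y ^+ 2 * L ^+ 4)) ^+ 2) ^+ 3).
Proof.
move=> sm1 sm2.
have Fb : `|F| <= 12 * 100 * (k * k) * (Y ^+ 2 * L ^+ 4) by have := F_bound; move: F1; rewrite -/F; lra.
have T4 : `|T| ^+ 4 <= K0 * (100 * F ^+ 2) ^+ 3.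
  apply: (@le_trans _ _ (K0 * `|s| ^+ 3 * `|T| ^+ 3)).
    by rewrite exprS ler_wpM2r // exprn_ge0.
  rewrite -mulrA -exprMn ler_pM2l // lerXn2r // nnegrE mulr_ge0 // sqr_ge0 //.
have T4' : `|T| ^+ 4 <= K0 * (100 * (12 * 100 * (k * k) * (Y ^+ 2 * L ^+ 4)) ^+ 2) ^+ 3.
  have g1 : F ^+ 2 <= (12 * 100 * (k * k) * (Y ^+ 2 * L ^+ 4)) ^+ 2.
    rewrite -[F ^+ 2]real_normK ?num_real // lerXn2r // nnegrE ?normr_ge0 //; exact: le_trans (normr_ge0 F) Fb.
  have g2 : 100 * F ^+ 2 <= 100 * (12 * 100 * (k * k) * (Y ^+ 2 * L ^+ 4)) ^+ 2 by rewrite ler_pM2l.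
  apply: le_trans T4 _; rewrite ler_pM2l //; apply: lerXn2r g2; rewrite nnegrE mulr_ge0 // sqr_ge0 //.
apply: (@le_trans _ _ ((2 * k ^+ 2 * X * `|T|) ^+ 4)).
  by rewrite lerXn2r ?nnegrE //; [exact: ltW | exact: le_trans (ltW Y0) T_lower | exact: T_lower].
by rewrite exprMn ler_wpM2l // exprn_ge0 // !mulr_ge0 ?exprn_ge0 // ltW.
Qed.

(** Second size condition, X^11 Y^5 L^5 M^3 >> 1: from |T| << |s|^3, with
    |T| >> X Y |del| and |s| << X^4 Y^2 M |del|^2. *)
Lemma X11Y5L5M3_lower :
  1 <= k ^+ 2 * K0 * (20 * k) ^+ 3 * (X ^+ 11 * Y ^+ 5 * M ^+ 3 * (k * L) ^+ 5).
Proof.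
have [m1 _] := S_main.
have del0 : 0 < `|del|.
  rewrite normr_gt0; apply/eqP => d0; move: m1; rewrite d0 mulr0 normr0; lra.
have h1 : X * Y * `|del| <= k ^+ 2 * (K0 * (20 * k * X ^+ 4 * Y ^+ 2 * M * `|del| ^+ 2) ^+ 3).
  apply: le_trans T_lower_del _; rewrite ler_pM2l ?exprn_gt0 //.
  apply: le_trans Ts3 _; rewrite ler_pM2l // lerXn2r ?nnegrE //.
    exact: le_trans s_bound.
  exact: s_bound.
have c0 : 0 < X * Y * `|del| by rewrite !mulr_gt0.
have h2 : 1 <= k ^+ 2 * K0 * (20 * k) ^+ 3 * (X ^+ 11 * Y ^+ 5 * M ^+ 3 * `|del| ^+ 5).
  rewrite -(ler_pM2r c0) mul1r; apply: le_trans h1 _.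
  by rewrite le_eqVlt; apply/orP; left; apply/eqP; ring.
apply: le_trans h2 _.
apply: ler_wpM2l; first by rewrite !mulr_ge0 ?exprn_ge0 ?mulr_ge0 // ltW.
apply: ler_wpM2l; first by rewrite !mulr_ge0 ?exprn_ge0 // ltW.
by rewrite lerXn2r ?nnegrE // mulr_ge0 // ltW.
Qed.

End Lower.
End Est.

(** * Linear inequalities between the logarithms of the sizes *)

(** The coefficient of x that remains at the end of exponents_contradiction
    when all other logarithms have been eliminated. *)
Lemma final_slope_neg (R : realFieldType) (lam : R) : 697 / 1000 < lam ->
  (1 - lam) * (11 * (1 - lam) + (8 * lam - 5) / 2) - lam * lam * (22 * lam - 13) <= - (1 / 30).
Proof.
move=> h; have [t t0 ->] : exists2 t, 0 < t & lam = 697 / 1000 + t.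
  by exists (lam - 697 / 1000); lra.
(* As a polynomial in t the left-hand side has only negative coefficients. *)
have := mulr_gt0 t0 t0; have := mulr_gt0 (mulr_gt0 t0 t0) t0; lra.
Qed.

(** Logarithms of the sizes attached to i and its successor j in I:
    x, z, y, q for the norms of x_i, x_(i+1), x_j, x_(j+1), and l, m for L_i
    and L_j. The number e absorbs all constants and is tiny compared with x. *)
Section Exponents.
Variables (R : realFieldType) (lam e x y z q l m : R).
Hypotheses (lam_lo : 697 / 1000 < lam) (lam_hi : lam <= 7 / 10).
Hypotheses (x0 : 0 < x) (e0 : 0 <= e) (xz : x <= z) (zy : z <= y) (yq : y <= q).
Hypotheses (hl : l <= e - lam * z) (hm : m <= e - lam * q).
Hypotheses (hy : y <= e + z + l + q + m) (hx : lam * x <= e + z + l).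

(* Linear arithmetic with all the hypotheses of the section. *)
Ltac slra := move: lam_lo lam_hi x0 e0 xz zy yq hl hm hy hx; lra.

Lemma z_lower : lam * x - 2 * e <= (1 - lam) * z.
Proof. by slra. Qed.

Lemma y_lower : 2 * x - 6 * e <= y.
Proof.
have : (1 - lam) * z <= 1 / 3 * y.
  apply: (@le_trans _ _ (1 / 3 * z)); last by slra.
  by apply: ler_wpM2r; slra.
have : 2 / 3 * x <= lam * x by apply: ler_wpM2r; slra.
by move: z_lower; slra.
Qed.

(** Eliminates q between hm and hy. *)
Lemma m_upper : (1 - lam) * m <= 2 * e + lam * (z + l - y).
Proof.
have h1 : lam * y <= lam * (e + z + l + q + m) by apply: ler_wpM2l; slra.
have : lam * e <= 1 * e by apply: ler_wpM2r; slra.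
by move: h1; slra.
Qed.

Lemma exponent_XL : 9 * e <= x -> x + 2 * l <= - e.
Proof.
have : lam * x <= lam * z by apply: ler_wpM2l; slra.
have : 697 / 1000 * x <= lam * x by apply: ler_wpM2r; slra.
by slra.
Qed.

Lemma exponent_XM : 40 * e <= x -> 3 * x + m - y <= - e.
Proof.
have : 697 / 1000 * q <= lam * q by apply: ler_wpM2r; slra.
by move: y_lower; slra.
Qed.

Lemma exponent_X4M2 : 40 * e <= x -> 4 * x + 2 * m <= - e.
Proof.
move=> ex.
have h1 : lam * (z + l) <= lam * (e + (1 - lam) * y).
  apply: ler_wpM2l; first by slra.
  have : (1 - lam) * z <= (1 - lam) * y by apply: ler_wpM2l => //; slra.
  by slra.
have h2 : lam * e <= 1 * e by apply: ler_wpM2r; slra.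
have h3 : 4 / 9 * y <= lam * lam * y.
  apply: ler_wpM2r; first by slra.
  have -> : 4 / 9 = 2 / 3 * (2 / 3) :> R by field.
  by apply: ler_pM; slra.
have h4 : (1 - lam) * x <= 1 / 3 * x by apply: ler_wpM2r; slra.
have h5 : (1 - lam) * (2 * x + m + e) <= 0.
  have : (1 - lam) * e <= 1 * e by apply: ler_wpM2r; slra.
  by move: m_upper y_lower; slra.
have : 2 * x + m + e <= 0.
  by rewrite -(ler_pM2l (_ : 0 < 1 - lam)) ?mulr0 //; slra.
by slra.
Qed.

(** This is where the threshold comes from: (5 - sqrt 13) / 2 is the smaller
    root of lam^2 - 5 lam + 3, and once m, l, y and z are eliminated in this
    order the left-hand side is at most (lam^2 - 5 lam + 3) x / (1 - lam)^2, up
    to a multiple of e. *)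
Lemma exponent_X3YLM : 3 * e <= - (lam ^+ 2 - 5 * lam + 3) * x ->
  3 * x + y + l + m <= - e.
Proof.
move=> ex.
have h1 : (1 - lam) * (3 * x + y + l + m) <= 3 * (1 - lam) * x + (1 - 2 * lam) * y + 3 * e.
  by move: m_upper; slra.
have h2 : (1 - 2 * lam) * ((1 - lam) * y) <= (1 - 2 * lam) * (lam * x - 2 * e).
  apply: ler_wnM2l; first by slra.
  apply: le_trans z_lower _.
  by apply: ler_wpM2l => //; slra.
have h3 := ler_wpM2l (_ : 0 <= 1 - lam) h1.
have h4 : (1 - lam) * ((1 - lam) * (3 * x + y + l + m + e)) <= 0.
  have l1 : lam * e <= 7 / 10 * e by apply: ler_wpM2r.
  have l2 : 697 / 1000 * e <= lam * e by apply: ler_wpM2r => //; apply: ltW.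
  have l3 : lam * lam * e <= 7 / 10 * (7 / 10) * e.
    by apply: ler_wpM2r => //; apply: ler_pM => //; slra.
  have := h3 ltac:(slra).
  by move: h2 ex; slra.
rewrite -subr_le0 opprK.
have lp : 0 < 1 - lam by slra.
by rewrite !(pmulr_rle0 _ lp) in h4.
Qed.

(** The last two inequalities are the logarithms of the size conditions
    X Y^2 L^6 >> 1 and X^11 Y^5 L^5 M^3 >> 1. The first bounds y from below by
    about 3 lam z - x / 2, the second from above, and z is at least about
    lam x / (1 - lam). *)
Lemma exponents_contradiction : 40 * (100 * e) <= x ->
  0 <= e + 4 * x + 8 * y + 24 * l -> 0 <= e + 11 * x + 5 * y + 5 * l + 3 * m -> False.
Proof.
move=> ex ha hb.
have h1 : 0 <= (1 - lam) * (e + 11 * x + 5 * y + 5 * l + 3 * m).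
  by apply: mulr_ge0 hb; move: lam_hi; lra.
have h2 : 3 * lam * z - 1 / 2 * x - 4 * e <= y by move: ha hl e0; lra.
have h3 := ler_wpM2l (_ : 0 <= 8 * lam - 5) h2.
have h4 := ler_wpM2l (_ : 0 <= 5 - 2 * lam) hl.
have lm : 0 <= 22 * lam - 13 by move: lam_lo; lra.
have ll : 0 <= lam by move: lam_lo; lra.
have h5 := ler_wpM2l (mulr_ge0 ll lm) z_lower.
have g1 := m_upper.
have g2 : 0 <= (11 * (1 - lam) + (8 * lam - 5) / 2) * x - lam * (22 * lam - 13) * z
   + (29 * lam - 8) * e.
  have {}h3 := h3 ltac:(move: lam_lo; lra).
  have {}h4 := h4 ltac:(move: lam_hi; lra).
  by move: h1 g1 h3 h4; lra.
have g3 := mulr_ge0 (_ : 0 <= 1 - lam) g2.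
have q1 : 0 <= ((1 - lam) * (11 * (1 - lam) + (8 * lam - 5) / 2) - lam * lam * (22 * lam - 13)) * x
   + 100 * e.
  have {}g3 := g3 ltac:(move: lam_hi; lra).
  have e1 : lam * e <= 1 * e by apply: ler_wpM2r => //; move: lam_hi; lra.
  have e2 : lam * lam * e <= 1 * 1 * e.
    by apply: ler_wpM2r => //; apply: ler_pM => //; move: lam_hi; lra.
  by move: g3 h5 e1 e2 e0; lra.
have q3 := ler_wpM2r (ltW x0) (final_slope_neg lam_lo).
by move: q1 q3 ex x0; lra.
Qed.
End Exponents.

(** * Heights of planes in three-space *)

Section Cross.
Variable A : comNzRingType.
Implicit Types p q r : 'rV[A]_3.

Definition cross p q : 'rV[A]_3 := \row_(k < 3)
  (p 0 (k + 1) * q 0 (k + 2) - p 0 (k + 2) * q 0 (k + 1)).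

Definition dot p q : A := p 0 0 * q 0 0 + p 0 1 * q 0 1 + p 0 2 * q 0 2.

Lemma cross0E p q : cross p q 0 0 = p 0 1 * q 0 2 - p 0 2 * q 0 1.
Proof. by rewrite mxE !add0r. Qed.
Lemma cross1E p q : cross p q 0 1 = p 0 2 * q 0 0 - p 0 0 * q 0 2.
Proof.
rewrite mxE (_ : 1 + 1 = 2 :> 'I_3); last exact/val_inj.
by rewrite (_ : 1 + 2 = 0 :> 'I_3); last exact/val_inj.
Qed.
Lemma cross2E p q : cross p q 0 2 = p 0 0 * q 0 1 - p 0 1 * q 0 0.
Proof.
rewrite mxE (_ : 2 + 1 = 0 :> 'I_3); last exact/val_inj.
by rewrite (_ : 2 + 2 = 1 :> 'I_3); last exact/val_inj.
Qed.
Definition crossE := (cross0E, cross1E, cross2E).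

Lemma row3P p q : p 0 0 = q 0 0 -> p 0 1 = q 0 1 -> p 0 2 = q 0 2 -> p = q.
Proof.
move=> h0 h1 h2; apply/rowP => -[[|[|[|//]]] h].
- by rewrite (_ : Ordinal h = 0) //; exact/val_inj.
- by rewrite (_ : Ordinal h = 1) //; exact/val_inj.
- by rewrite (_ : Ordinal h = 2) //; exact/val_inj.
Qed.

Lemma crossC p q : cross p q = - cross q p.
Proof. by apply: row3P; rewrite [RHS]mxE !crossE; ring. Qed.

Lemma dot_cross_l p q : dot (cross p q) p = 0.
Proof. by rewrite /dot !crossE; ring. Qed.

Lemma dot_cross_r p q : dot (cross p q) q = 0.
Proof. by rewrite /dot !crossE; ring. Qed.

(** The plane orthogonal to w contains p, so the two planes with normal vectors
    w and cross p q meet along p. *)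
Lemma cross_cross w p q : dot w p = 0 -> cross w (cross p q) = dot w q *: p.
Proof.
move=> wp; have -> : cross w (cross p q) = dot w q *: p - dot w p *: q.
  by apply: row3P; rewrite !(crossE, mxE) /dot; ring.
by rewrite wp scale0r subr0.
Qed.

Lemma det33 (B : 'M[A]_3) : \det B =
  B 0 0 * (B 1 1 * B 2 2 - B 1 2 * B 2 1) - B 0 1 * (B 1 0 * B 2 2 - B 1 2 * B 2 0)
  + B 0 2 * (B 1 0 * B 2 1 - B 1 1 * B 2 0).
Proof.
have i1 : lift 0 0 = 1 :> 'I_3 by exact/val_inj.
have i2 : lift 0 1 = 2 :> 'I_3 by exact/val_inj.
have i4 : lift 0 0 = 1 :> 'I_2 by exact/val_inj.
have j1 : lift 1 0 = 0 :> 'I_3 by exact/val_inj.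
have j2 : lift 1 1 = 2 :> 'I_3 by exact/val_inj.
have k1 : lift 2 0 = 0 :> 'I_3 by exact/val_inj.
have k2 : lift 2 1 = 1 :> 'I_3 by exact/val_inj.
rewrite (expand_det_row _ 0) !big_ord_recl big_ord0 /cofactor.
rewrite !(expand_det_row _ 0) !big_ord_recl !big_ord0 /cofactor !det_mx11 !mxE.
rewrite -[ord0]/(0 : 'I_3) -[ord0]/(0 : 'I_2) -[ord0]/(0 : 'I_1).
have l1 : lift 1 (0 : 'I_1) = 0 :> 'I_2 by exact/val_inj.
rewrite ?(i4, l1) ?(i1,i2,j1,j2,k1,k2).
rewrite !expr0 /=; ring.
Qed.

Lemma det_col3 p q r : \det (col_mx p (col_mx q r) : 'M[A]_(1 + (1 + 1), 3)) = dot (cross p q) r.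
Proof.
set B : 'M[A]_3 := (X in \det X).
have e0 j : B 0 j = p 0 j.
  rewrite (_ : 0 = lshift (1 + 1) (0 : 'I_1)); last exact/val_inj.
  exact: (col_mxEu p (col_mx q r)).
have e1 j : B 1 j = q 0 j.
  rewrite (_ : 1 = rshift 1 (lshift 1 (0 : 'I_1))); last exact/val_inj.
  by apply: etrans (col_mxEd p (col_mx q r) _ _) _; rewrite col_mxEu.
have e2 j : B 2 j = r 0 j.
  rewrite (_ : 2 = rshift 1 (rshift 1 (0 : 'I_1))); last exact/val_inj.
  by apply: etrans (col_mxEd p (col_mx q r) _ _) _; rewrite col_mxEd.
by rewrite det33 !(e0, e1, e2) /dot !crossE; ring.
Qed.
End Cross.

Section Heights.
Variable R : realType.
Implicit Types (v w : 'rV[int]_3) (xi k : R).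

Lemma toRE v j : toR R v 0 j = (v 0 j)%:~R.
Proof. by rewrite /toR mxE. Qed.

Lemma lin_indep_pointsE u v w : lin_indep_points u v w = (dot (cross u v) w != 0).
Proof.
rewrite /lin_indep_points row_free_unit unitmxE.
by rewrite (det_map_mx intr (col_mx u (col_mx v w) : 'M[int]_3)) det_col3 unitfE intr_eq0.
Qed.

Definition nat_norm v : nat := maxn (maxn `|v 0 0| `|v 0 1|) `|v 0 2|.

Lemma nat_norm_eq0 v : (nat_norm v <= 0)%N -> v = 0.
Proof.
rewrite !geq_max !leqn0 !absz_eq0 => /andP[/andP[/eqP h0 /eqP h1] /eqP h2].
by apply: row3P; rewrite mxE.
Qed.

Lemma supnormE v : supnorm (toR R v) = (nat_norm v)%:R.
Proof.
by rewrite /supnorm !toRE /nat_norm !natr_max -!intr_norm -!abszE.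
Qed.

Lemma supnorm_ge v j : `|(v 0 j)%:~R| <= supnorm (toR R v).
Proof.
have jj : j = 0 \/ j = 1 \/ j = 2.
  by case: j => -[|[|[|//]]] h; [left|right; left|right; right]; exact/val_inj.
rewrite /supnorm !le_max !toRE.
by case: jj => [->|[->|->]]; rewrite lexx ?orbT.
Qed.

Lemma supnormZ a v : supnorm (toR R (a *: v)) = `|a%:~R| * supnorm (toR R v).
Proof. by rewrite /supnorm !toRE !mxE !intrM !normrM !maxr_pMr. Qed.

Lemma LxiZ xi a v : Lxi xi (toR R (a *: v)) = `|a%:~R| * Lxi xi (toR R v).
Proof.
rewrite /Lxi !toRE !mxE !intrM maxr_pMr // -!normrM.
by rewrite !mulrBr !mulrA.
Qed.

Lemma Lxi1 xi v : `|(v 0 1)%:~R - (v 0 0)%:~R * xi| <= Lxi xi (toR R v).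
Proof. by rewrite /Lxi !toRE le_max lexx. Qed.

Lemma Lxi2 xi v : `|(v 0 2)%:~R - (v 0 0)%:~R * xi ^+ 3| <= Lxi xi (toR R v).
Proof. by rewrite /Lxi !toRE le_max lexx orbT. Qed.

Lemma Lxi_gt0 xi v : lin_indep_rat 1 xi (xi ^+ 3) -> v != 0 -> 0 < Lxi xi (toR R v).
Proof.
move=> indep v0; rewrite lt_def; apply/andP; split; last first.
  exact: le_trans (normr_ge0 _) (Lxi1 xi v).
apply: contraNneq v0 => L0.
have h1 : (v 0 1)%:~R - (v 0 0)%:~R * xi = 0.
  by apply/eqP; rewrite -normr_le0 -L0 Lxi1.
have h2 : (v 0 2)%:~R - (v 0 0)%:~R * xi ^+ 3 = 0.
  by apply/eqP; rewrite -normr_le0 -L0 Lxi2.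
have [/eqP a1 /eqP a2 _] := indep (v 0 1)%:~R (- (v 0 0))%:~R 0
  ltac:(by rewrite !ratr_int rmorph0 mulr1 mul0r addr0 intrN mulNr).
have [/eqP a3 _ _] := indep (v 0 2)%:~R 0 (- (v 0 0))%:~R
  ltac:(by rewrite !ratr_int rmorph0 mulr1 mul0r addr0 intrN mulNr).
apply/eqP; apply: row3P; rewrite !mxE.
- by move: a2; rewrite intr_eq0 oppr_eq0 => /eqP.
- by move: a1; rewrite intr_eq0 => /eqP.
- by move: a3; rewrite intr_eq0 => /eqP.
Qed.

(** A point close to the line spanned by (1, xi, xi^3) has a first coordinate
    of the order of its norm. *)
Lemma supnorm_le_head xi v k : 1 + `|xi| + `|xi| ^+ 3 <= k -> v != 0 ->
  Lxi xi (toR R v) < 1 / 2 -> supnorm (toR R v) <= k * `|(v 0 0)%:~R|.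
Proof.
move=> hk v0 L12.
have h1 := le_lt_trans (Lxi1 xi v) L12.
have h2 := le_lt_trans (Lxi2 xi v) L12.
have small (a : int) : `|a%:~R : R| < 1 / 2 -> a = 0.
  move=> ha; apply/eqP; rewrite -normr_le0 -ltzD1 add0r -(ltr_int R) intr_norm.
  by apply: lt_trans ha _; lra.
have a0 : 1 <= `|(v 0 0)%:~R : R|.
  rewrite -intr_norm -[1]/(1%:~R) ler_int -gtz0_ge1 normr_gt0.
  apply: contraNneq v0 => a0; rewrite a0 !mul0r !subr0 in h1 h2.
  by apply/eqP/row3P; rewrite !mxE //; exact: small.
have ge1 : 0 <= `|xi| by [].
have ge3 : 0 <= `|xi| ^+ 3 by rewrite exprn_ge0.
have b1 : `|(v 0 1)%:~R| <= k * `|(v 0 0)%:~R|.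
  rewrite -[X in `|X|](subrK ((v 0 0)%:~R * xi)).
  apply: le_trans (ler_normD _ _) _; rewrite normrM.
  have : (1 + `|xi|) * `|(v 0 0)%:~R : R| <= k * `|(v 0 0)%:~R| by apply: ler_wpM2r => //; lra.
  by move: h1 a0; lra.
have b2 : `|(v 0 2)%:~R| <= k * `|(v 0 0)%:~R|.
  rewrite -[X in `|X|](subrK ((v 0 0)%:~R * xi ^+ 3)).
  apply: le_trans (ler_normD _ _) _; rewrite normrM normrX.
  have : (1 + `|xi| ^+ 3) * `|(v 0 0)%:~R : R| <= k * `|(v 0 0)%:~R| by apply: ler_wpM2r => //; lra.
  by move: h2 a0; lra.
have b0 : `|(v 0 0)%:~R : R| <= k * `|(v 0 0)%:~R|.
  by rewrite -[leLHS]mul1r; apply: ler_wpM2r => //; lra.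
by rewrite /supnorm !toRE !ge_max b0 b1 b2.
Qed.

(** The height of the plane spanned by v and w. *)
Lemma cross_bound xi v w k : 1 + `|xi| + `|xi| ^+ 3 <= k ->
  supnorm (toR R v) <= supnorm (toR R w) -> Lxi xi (toR R w) <= Lxi xi (toR R v) ->
  supnorm (toR R (cross v w)) <= 2 * k * (supnorm (toR R w) * Lxi xi (toR R v)).
Proof.
move=> hk hX hL.
set X := supnorm (toR R w) in hX *; set L := Lxi xi (toR R v) in hL *.
have X0 : 0 <= X by exact: le_trans (normr_ge0 _) (supnorm_ge w 0).
have L0 : 0 <= L by exact: le_trans (normr_ge0 _) (Lxi1 xi v).
have vX j : `|(v 0 j)%:~R : R| <= X by exact: le_trans (supnorm_ge v j) hX.
have wX j : `|(w 0 j)%:~R : R| <= X by exact: supnorm_ge.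
have v1 := Lxi1 xi v; have v2 := Lxi2 xi v.
have w1 := le_trans (Lxi1 xi w) hL; have w2 := le_trans (Lxi2 xi w) hL.
rewrite -/L in v1 v2.
have diff (a b c d : R) : `|a| <= X -> `|b| <= L -> `|c| <= X -> `|d| <= L ->
    `|a * b - c * d| <= 2 * (X * L).
  move=> ha hb hc hd; apply: le_trans (ler_normB _ _) _; rewrite !normrM.
  have := ler_pM (normr_ge0 _) (normr_ge0 _) ha hb.
  by have := ler_pM (normr_ge0 _) (normr_ge0 _) hc hd; lra.
have XL : 0 <= X * L by rewrite mulr_ge0.
have xi0 : 0 <= `|xi| by [].
have xi3 : 0 <= `|xi| ^+ 3 by rewrite exprn_ge0.
have kXL : 2 * (X * L) * (1 + `|xi| ^+ 3) <= 2 * k * (X * L).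
  rewrite [leRHS](_ : _ = 2 * (X * L) * k); last by ring.
  by rewrite ler_wpM2l ?mulr_ge0 //; lra.
have kXL' : 2 * (X * L) <= 2 * k * (X * L).
  apply: le_trans kXL; rewrite ler_peMr ?mulr_ge0 //; lra.
have c2 : `|(cross v w 0 2)%:~R : R| <= 2 * (X * L).
  rewrite cross2E (_ : _%:~R = (v 0 0)%:~R * ((w 0 1)%:~R - (w 0 0)%:~R * xi)
    - (w 0 0)%:~R * ((v 0 1)%:~R - (v 0 0)%:~R * xi)); last by ring.
  exact: diff.
have c1 : `|(cross v w 0 1)%:~R : R| <= 2 * (X * L).
  rewrite cross1E (_ : _%:~R = (w 0 0)%:~R * ((v 0 2)%:~R - (v 0 0)%:~R * xi ^+ 3)
    - (v 0 0)%:~R * ((w 0 2)%:~R - (w 0 0)%:~R * xi ^+ 3)); last by ring.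
  exact: diff.
have c0 : `|(cross v w 0 0)%:~R : R| <= 2 * k * (X * L).
  rewrite cross0E (_ : _%:~R = ((v 0 1)%:~R * ((w 0 2)%:~R - (w 0 0)%:~R * xi ^+ 3)
    - (w 0 1)%:~R * ((v 0 2)%:~R - (v 0 0)%:~R * xi ^+ 3))
    - xi ^+ 3 * (cross v w 0 2)%:~R); last by rewrite cross2E; ring.
  apply: le_trans (ler_normB _ _) _; rewrite normrM normrX.
  have d1 := diff _ _ _ _ (vX 1) w2 (wX 1) v2.
  have d2 := ler_wpM2l xi3 c2.
  by move: kXL d1 d2; lra.
by rewrite /supnorm !toRE !ge_max c0 !(le_trans _ kXL').
Qed.

End Heights.

(** * Geometry of a sequence of minimal points *)

Lemma coprime_common_divisor (a b : int) (p q : 'rV[int]_3) :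
  a != 0 -> coprimez a b -> a *: q = b *: p -> exists v, p = a *: v /\ q = b *: v.
Proof.
move=> a0 cab e; have ek (k : 'I_3) : a * q 0 k = b * p 0 k.
  by have := congr1 (fun r : 'rV[int]_3 => r 0 k) e; rewrite !mxE.
have ap (k : 'I_3) : a * divz (p 0 k) a = p 0 k.
  rewrite mulrC divzK // -(Gauss_dvdzr _ cab) -ek; exact: dvdz_mulr.
exists (\row_k divz (p 0 k) a); split; apply/rowP => k; rewrite !mxE ?ap //.
by apply: (mulfI a0); rewrite ek -[in LHS]ap; ring.
Qed.

Lemma cross_eq0_dot (w c z : 'rV[int]_3) :
  cross w c = 0 -> c != 0 -> dot c z = 0 -> dot w z = 0.
Proof.
move=> wc c0 cz.
have h0 : w 0 1 * c 0 2 = w 0 2 * c 0 1.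
  by apply/eqP; rewrite -subr_eq0 -cross0E wc mxE.
have h1 : w 0 2 * c 0 0 = w 0 0 * c 0 2.
  by apply/eqP; rewrite -subr_eq0 -cross1E wc mxE.
have h2 : w 0 0 * c 0 1 = w 0 1 * c 0 0.
  by apply/eqP; rewrite -subr_eq0 -cross2E wc mxE.
have [k ck] : exists k, c 0 k != 0.
  by apply/existsP; apply: contraNT c0 => /existsPn h; apply/eqP/rowP => k; rewrite mxE; apply/eqP/negPn/h.
have : c 0 k * dot w z = w 0 k * dot c z.
  have : k = 0 \/ k = 1 \/ k = 2.
    by case: k ck => -[|[|[|//]]] h _; [left|right; left|right; right]; exact/val_inj.
  rewrite /dot => -[->|[->|->]].
  - rewrite !mulrDr !mulrA -[c 0 0 * w 0 1]mulrC -h2 -[c 0 0 * w 0 2]mulrC h1; ring.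
  - rewrite !mulrDr !mulrA -[c 0 1 * w 0 0]mulrC h2 -[c 0 1 * w 0 2]mulrC -h0; ring.
  - rewrite !mulrDr !mulrA -[c 0 2 * w 0 0]mulrC -h1 -[c 0 2 * w 0 1]mulrC h0; ring.
by rewrite cz mulr0 => /eqP; rewrite mulf_eq0 (negbTE ck) => /eqP.
Qed.

Section Minimal.
Variables (R : realType) (xi : R) (x : nat -> 'rV[int]_3).
Hypotheses (indep : lin_indep_rat 1 xi (xi ^+ 3)) (xmin : minimal_points xi x).

Let X i := supnorm (toR R (x i)).
Let L i := Lxi xi (toR R (x i)).

Lemma minimal_neq0 i : (1 <= i)%N -> x i != 0.
Proof. by case: xmin => h *; exact: h. Qed.

Lemma minimal_norm_lt i : (1 <= i)%N -> X i < X i.+1.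
Proof. by case: xmin => _ h *; exact: h. Qed.

Lemma minimal_norm_le i j : (1 <= i)%N -> (i <= j)%N -> X i <= X j.
Proof.
move=> i1; elim: j => [|j IH]; first by rewrite leqn0 => /eqP ->.
rewrite leq_eqVlt => /orP[/eqP ->//|]; rewrite ltnS => ij.
by apply: le_trans (IH ij) (ltW (minimal_norm_lt _)); exact: leq_trans ij.
Qed.

Lemma minimal_L_le i j : (1 <= i)%N -> (i <= j)%N -> L j <= L i.
Proof.
move=> i1; elim: j => [|j IH]; first by rewrite leqn0 => /eqP ->.
rewrite leq_eqVlt => /orP[/eqP ->//|]; rewrite ltnS => ij.
apply: le_trans (IH ij); case: xmin => _ _ _ h _; apply/ltW/h; exact: leq_trans ij.
Qed.

Lemma minimal_L_lt_half i : (1 <= i)%N -> L i < 1 / 2.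
Proof. by move=> i1; apply: le_lt_trans (minimal_L_le _ i1) _ => //; case: xmin. Qed.

Lemma minimal_L_gt0 i : (1 <= i)%N -> 0 < L i.
Proof. by move=> i1; apply: Lxi_gt0 => //; exact: minimal_neq0. Qed.

Lemma minimal_norm_ge i : i%:R <= X i.
Proof.
elim: i => [|[|i] IH]; rewrite /X supnormE ler_nat //.
  apply: contraNT (minimal_neq0 (leqnn 1)); rewrite -leqNgt => h.
  by apply/eqP/nat_norm_eq0.
have := minimal_norm_lt (ltn0Sn i); rewrite /X supnormE in IH *.
rewrite supnormE ltr_nat; rewrite ler_nat in IH; exact: leq_ltn_trans.
Qed.

(** If |a| > 1, then v has a smaller L than x i, so a norm at least that of
    x i.+1 by minimality, although its norm is at most that of x i. *)
Lemma minimal_primitive i a v : (1 <= i)%N -> x i = a *: v -> `|a| = 1.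
Proof.
move=> i1 xav; have xi0 := minimal_neq0 i1.
have a0 : a != 0 by apply: contraNneq xi0 => a0; rewrite xav a0 scale0r.
have v0 : v != 0 by apply: contraNneq xi0 => v0; rewrite xav v0 scaler0.
have a1 : 1 <= `|a| by rewrite -gtz0_ge1 normr_gt0.
apply/eqP; rewrite eq_le a1 andbT leNgt; apply/negP => a2.
have Lv := Lxi_gt0 indep v0.
have h : Lxi xi (toR R v) < L i.
  by rewrite /L xav LxiZ -intr_norm ltr_pMl // -[1]/(1%:~R) ltr_int.
case: xmin => _ _ _ _ /(_ v i v0 i1 h) h2.
have := lt_le_trans (minimal_norm_lt i1) h2; apply/negP; rewrite -leNgt /X xav supnormZ.
rewrite -intr_norm ler_peMl //; last by rewrite -[1]/(1%:~R) ler_int.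
by rewrite supnormE ler0n.
Qed.

Lemma head_neq0 i : (1 <= i)%N -> x i 0 0 != 0.
Proof.
move=> i1; apply: contraNneq (minimal_neq0 i1) => h.
have := supnorm_le_head (lexx _) (minimal_neq0 i1) (minimal_L_lt_half i1).
rewrite h normr0 mulr0 supnormE -[0]/(0%:R) ler_nat => h2.
by apply/eqP/nat_norm_eq0.
Qed.

(** Two proportional primitive points are equal up to sign, whereas the norms of
    consecutive minimal points differ. *)
Lemma cross_consecutive i : (1 <= i)%N -> cross (x i) (x i.+1) != 0.
Proof.
move=> i1; apply/eqP => c0; set p := x i in c0; set q := x i.+1 in c0.
have [g [a [b [g0 ea eb cab]]]] := coprime_reduction (p 0 0) (head_neq0 (ltn0Sn i)).
have a0 : a != 0 by apply: contraNneq (head_neq0 i1) => a0; rewrite ea a0 mul0r.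
have c2 : p 0 0 * q 0 1 = p 0 1 * q 0 0.
  by apply/eqP; rewrite -subr_eq0 -cross2E c0 mxE.
have c1 : p 0 2 * q 0 0 = p 0 0 * q 0 2.
  by apply/eqP; rewrite -subr_eq0 -cross1E c0 mxE.
have gn : g != 0 by rewrite gt_eqF.
have e : a *: q = b *: p.
  apply: row3P; rewrite !mxE; apply: (mulfI gn).
  - by rewrite ea eb; ring.
  - by rewrite mulrA [g * a]mulrC -ea c2 eb; ring.
  - by rewrite mulrA [g * a]mulrC -ea -c1 eb; ring.
have [v [pv qv]] := coprime_common_divisor a0 cab e.
have := minimal_norm_lt i1; rewrite /X -/p -/q pv qv !supnormZ -!intr_norm.
by rewrite (minimal_primitive i1 pv) (minimal_primitive (ltn0Sn i) qv) ltxx.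
Qed.

Lemma indexIP i : indexI x i <-> (2 <= i)%N /\ dot (cross (x i.-1) (x i)) (x i.+1) != 0.
Proof. by rewrite /indexI /= lin_indep_pointsE. Qed.

(** No index strictly between i and j belongs to I, so all the points from
    x i to x j lie in the plane spanned by x i and x i.+1. *)
Lemma successor_plane i j k : successor_in (indexI x) i j -> (i <= k)%N -> (k < j)%N ->
  dot (cross (x i) (x i.+1)) (x k) = 0 /\ dot (cross (x i) (x i.+1)) (x k.+1) = 0.
Proof.
move=> [/indexIP[i2 _] _ _ sij]; elim: k => [|k IH]; first by rewrite leqn0 => /eqP i0; rewrite i0 in i2.
rewrite leq_eqVlt => /orP[/eqP ik _|]; first by rewrite -ik dot_cross_l dot_cross_r.
rewrite ltnS => ik kj; have [d1 d2] := IH ik (ltnW kj); split=> //.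
have k1 : (1 <= k)%N by apply: leq_trans ik; exact: ltnW.
have c0 := cross_consecutive k1.
apply: (cross_eq0_dot _ c0); first by rewrite (cross_cross _ d1) d2 scale0r.
apply/eqP/negPn/negP => h.
have : indexI x k.+1 by apply/indexIP.
by move=> /sij; rewrite ltnS ik leqNgt kj => /(_ isT).
Qed.

(** The planes spanned by x i, x i.+1 and by x j, x j.+1 are distinct and meet
    along x j: the cross product of their normal vectors is a non-zero integral
    multiple of x j, and its norm is at most a constant times the product of
    the two heights. *)
Lemma successor_height k i j : 1 + `|xi| + `|xi| ^+ 3 <= k -> successor_in (indexI x) i j ->
  X j <= 8 * k ^+ 2 * ((X i.+1 * L i) * (X j.+1 * L j)).
Proof.
move=> hk sij; have [/indexIP[i2 _] /indexIP[j2 jd] ij _] := sij.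
have i1 : (1 <= i)%N by exact: ltnW.
have j1 : (1 <= j)%N by exact: ltnW.
have jj : j.-1.+1 = j by rewrite prednK.
have [d1 d2] := @successor_plane i j j.-1 sij ltac:(by rewrite -ltnS jj) ltac:(by rewrite ltn_predL).
rewrite jj in d2.
set w := cross (x i) (x i.+1) in d1 d2.
have w0 : w != 0 by exact: cross_consecutive.
have d3 : dot w (x j.+1) != 0.
  apply: contraNneq jd => d3; apply/eqP; apply: (cross_eq0_dot _ w0) d3.
  by rewrite crossC (cross_cross _ d1) d2 scale0r oppr0.
have e := cross_cross (x j.+1) d2.
have ub1 := cross_bound hk (ltW (minimal_norm_lt i1)) (minimal_L_le i1 (leqnSn i)).
have ub2 := cross_bound hk (ltW (minimal_norm_lt j1)) (minimal_L_le j1 (leqnSn j)).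
rewrite -/w in ub1; set w' := cross (x j) (x j.+1) in e ub2.
have Xn i' : 0 <= supnorm (toR R i') by rewrite supnormE.
have h1 : X j <= supnorm (toR R (cross w w')).
  by rewrite e supnormZ -intr_norm ler_peMl ?Xn // (ler_int R 1) -gtz0_ge1 normr_gt0.
have h2 : supnorm (toR R (cross w w')) <= 2 * (supnorm (toR R w) * supnorm (toR R w')).
  have b a c a' c' : `|(w 0 a)%:~R * (w' 0 c)%:~R - (w 0 a')%:~R * (w' 0 c')%:~R : R|
     <= 2 * (supnorm (toR R w) * supnorm (toR R w')).
    apply: le_trans (ler_normB _ _) _; rewrite !normrM mulr_natl mulr2n.
    by apply: lerD; apply: ler_pM => //; exact: supnorm_ge.
  by rewrite [leLHS]/supnorm !toRE (cross0E w w') (cross1E w w') (cross2E w w') !intrB !intrM !ge_max !b.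
apply: le_trans h1 (le_trans h2 _).
have -> : 8 * k ^+ 2 * ((X i.+1 * L i) * (X j.+1 * L j)) =
  2 * ((2 * k * (X i.+1 * L i)) * (2 * k * (X j.+1 * L j))) by ring.
by rewrite ler_pM2l //; apply: ler_pM.
Qed.

End Minimal.

Lemma int_eq0_lt1 (R : realDomainType) (a : int) : `|a%:~R : R| < 1 -> a = 0.
Proof.
move=> h; apply/eqP; rewrite -normr_le0 -ltzD1 add0r -(ltr_int R) intr_norm.
exact: h.
Qed.

Section Minimal.
Variables (R : realType) (xi : R) (x : nat -> 'rV[int]_3).
Hypotheses (indep : lin_indep_rat 1 xi (xi ^+ 3)) (xmin : minimal_points xi x).

Let X i := supnorm (toR R (x i)).
Let L i := Lxi xi (toR R (x i)).

(** Apply the approximation hypothesis just below the norm of x i.+1, at half of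
    it: the point obtained has L at least L i by minimality. *)
Lemma approx_log (lambda c lam : R) : 0 < c -> 0 <= lam -> lam <= lambda ->
  (\forall X \near +oo, exists y : 'rV[int]_3,
       [/\ y != 0, supnorm (toR R y) <= X &
           Lxi xi (toR R y) <= c * X `^ (- lambda)]) ->
  exists kap, exists N, forall i, (N <= i)%N -> ln (L i) <= kap - lam * ln (X i.+1).
Proof.
move=> c0 lam0 lamle [A [_ hA]].
exists (ln c + lambda * ln 2), (Num.bound (2 * `|A|)).+1 => i Ni.
have i1 : (1 <= i)%N by exact: leq_trans Ni.
have Xi : i.+1%:R <= X i.+1 := minimal_norm_ge xmin i.+1.
have X1 : 1 <= X i.+1 by apply: le_trans Xi; rewrite ler1n.
have X0 : 0 < X i.+1 by exact: lt_le_trans X1.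
have XA : A < X i.+1 / 2.
  have b := archi_boundP (_ : 0 <= 2 * `|A|).
  have {}b := b (mulr_ge0 (ler0n _ 2) (normr_ge0 A)).
  have : (Num.bound (2 * `|A|))%:R <= i.+1%:R :> R by rewrite ler_nat; apply: ltnW; apply: leq_trans Ni _.
  by have := ler_norm A; move: b Xi; lra.
have [y [y0 yX Ly]] := hA _ XA.
have LL : L i <= c * (X i.+1 / 2) `^ (- lambda).
  apply: le_trans Ly; rewrite leNgt; apply/negP => h.
  case: xmin => _ _ _ _ /(_ y i y0 i1 h) h2.
  by have := le_trans h2 yX; rewrite -/(X i.+1); lra.
have L0 : 0 < L i := minimal_L_gt0 indep xmin i1.
have h : ln (L i) <= ln (c * (X i.+1 / 2) `^ (- lambda)).
  by rewrite ler_ln // posrE ?(lt_le_trans L0).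
apply: le_trans h _.
have X2 : 0 < X i.+1 / 2 by rewrite divr_gt0.
rewrite lnM ?posrE ?powR_gt0 // ln_powR ln_div ?posrE //.
have : lam * ln (X i.+1) <= lambda * ln (X i.+1) by rewrite ler_wpM2r // ln_ge0.
lra.
Qed.

(** A primitive zero of x0^2 x2 - x1^3 is, up to sign, (p^3, p^2 q, q^3) with p
    and q coprime. If the product on the right were less than 1, then p^2 L_i
    would be small, which forces the integers y0 q - y1 p and, with m = y0 / p,
    m q^3 - y2 p^2 to vanish for the previous minimal point y; then y would be
    proportional to x i.+1. *)
Lemma phi_zero_bound k i : 1 + `|xi| + `|xi| ^+ 3 <= k -> (1 <= i)%N -> phi (x i.+1) = 0 ->
  1 <= 8 * k ^+ 3 * (X i.+1 ^+ 2 * L i ^+ 3).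
Proof.
move=> hk i1 phi0; rewrite leNgt; apply/negP => small.
set p' := x i.+1 in phi0; set y := x i.
have x00 : p' 0 0 != 0 := head_neq0 xmin (ltn0Sn i).
have [g [q [p [g0 e1 e0 cqp]]]] := coprime_reduction (p' 0 1) x00.
have gn : g != 0 by rewrite gt_eqF.
have pn : p != 0 by apply: contraNneq x00 => h; rewrite e0 h mul0r.
have e2 : p ^+ 2 * p' 0 2 = q ^+ 3 * g.
  have g2 : g ^+ 2 != 0 by rewrite expf_neq0.
  apply: (mulfI g2); move: phi0; rewrite /phi e0 e1 => /eqP; rewrite subr_eq0 => /eqP h.
  rewrite [LHS](_ : _ = (p * g) ^+ 2 * p' 0 2); last by ring.
  by rewrite h; ring.
have pg : (p ^+ 2 %| g)%Z.
  have c : coprimez (p ^+ 2) (q ^+ 3) by rewrite coprimezXl // coprimezXr // coprimez_sym.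
  by rewrite -(Gauss_dvdzr _ c) -e2 dvdz_mulr.
move/dvdzP: pg => [h gh].
pose v : 'rV[int]_3 := \row_k nth 0 [:: p ^+ 3; p ^+ 2 * q; q ^+ 3] k.
have v0 : v 0 0 = p ^+ 3 by rewrite mxE.
have v1 : v 0 1 = p ^+ 2 * q by rewrite mxE.
have v2 : v 0 2 = q ^+ 3 by rewrite mxE.
have xv : p' = h *: v.
  apply: row3P; rewrite [RHS]mxE ?v0 ?v1 ?v2.
  - by rewrite e0 gh; ring.
  - by rewrite e1 gh; ring.
  - by apply: (mulfI (expf_neq0 2 pn)); rewrite e2 gh; ring.
have h1 := minimal_primitive indep xmin (ltn0Sn i) xv.
have nh : `|h%:~R| = 1 :> R by rewrite -intr_norm h1.
have Xv : supnorm (toR R v) = X i.+1 by rewrite /X -/p' xv supnormZ nh mul1r.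
have Lv : Lxi xi (toR R v) = L i.+1 by rewrite /L -/p' xv LxiZ nh mul1r.
have hn : h != 0 by rewrite -normr_eq0 h1.
have vn : v != 0 by apply: contraNneq x00 => vz; rewrite xv vz scaler0 mxE.
have L12 : Lxi xi (toR R v) < 1 / 2 by rewrite Lv; exact: (minimal_L_lt_half xmin).
have Xk := supnorm_le_head hk vn L12; rewrite Xv v0 in Xk.
have Li := minimal_L_le xmin i1 (leqnSn i); rewrite -/(L i) -/(L i.+1) in Li.
have Yi := ltW (minimal_norm_lt xmin i1); rewrite -/(X i) -/(X i.+1) in Yi.
pose P : R := p%:~R; pose yr j : R := (y 0 j)%:~R.
have a1 := Lxi1 xi v; have a2 := Lxi2 xi v; have b1 := Lxi1 xi y; have b2 := Lxi2 xi y.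
rewrite Lv v0 v1 in a1; rewrite Lv v0 v2 in a2.
have Yy := supnorm_ge R y 0; rewrite -/(X i) in Yy.
have Pp : 0 < `|P| by rewrite normr_gt0 intr_eq0.
have P3 : `|(p ^+ 3)%:~R| = `|P| ^+ 3 by rewrite rmorphXn normrX.
rewrite P3 in Xk.
have L0 : 0 < L i := minimal_L_gt0 indep xmin i1.
have k0 : 0 < k.
  apply: lt_le_trans hk; have : 0 <= `|xi| by []. 
  by have := exprn_ge0 3 (normr_ge0 xi); lra.
have smallP : 2 * k * `|P| ^+ 2 * L i < 1.
  rewrite -(@ltr_pXn2r _ 3) // ?nnegrE ?expr1n //; last first.
    by rewrite !mulr_ge0 ?exprn_ge0 // ltW.
  apply: le_lt_trans small.
  have : `|P| ^+ 3 <= X i.+1 by rewrite -P3 -v0 -Xv; exact: supnorm_ge.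
  move=> hP; have hP2 : (`|P| ^+ 3) ^+ 2 <= X i.+1 ^+ 2.
    by rewrite lerXn2r ?nnegrE ?exprn_ge0 // -Xv supnormE.
  rewrite [leLHS](_ : _ = 8 * k ^+ 3 * ((`|P| ^+ 3) ^+ 2 * L i ^+ 3)); last by ring.
  apply: ler_wpM2l; first by rewrite mulr_ge0 // exprn_ge0 // ltW.
  by apply: ler_wpM2r => //; rewrite exprn_ge0 // ltW.
have P1 : 1 <= `|P| by rewrite -intr_norm (ler_int R 1) -gtz0_ge1 normr_gt0.
have XL : `|yr 0| * L i.+1 + `|P| ^+ 3 * L i <= 2 * k * `|P| ^+ 3 * L i.
  have hy : `|yr 0| * L i.+1 <= X i.+1 * L i.
    by apply: ler_pM => //; [exact: ltW (minimal_L_gt0 indep xmin (ltn0Sn i)) | exact: le_trans Yi].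
  have hx : X i.+1 * L i <= k * `|P| ^+ 3 * L i by rewrite ler_pM2r.
  have : 1 * (`|P| ^+ 3 * L i) <= k * (`|P| ^+ 3 * L i).
    apply: ler_wpM2r; first by rewrite mulr_ge0 ?exprn_ge0 // ltW.
    apply: le_trans hk; have : 0 <= `|xi| by [].
    by have := exprn_ge0 3 (normr_ge0 xi); lra.
  by move: hy hx; lra.
have z1 : y 0 0 * q - y 0 1 * p = 0.
  apply: (@int_eq0_lt1 R); rewrite -(ltr_pM2l (exprn_gt0 2 Pp)) mulr1.
  have -> : `|P| ^+ 2 * `|(y 0 0 * q - y 0 1 * p)%:~R| =
     `|yr 0 * ((p ^+ 2 * q)%:~R - (p ^+ 3)%:~R * xi) - (p ^+ 3)%:~R * ((y 0 1)%:~R - (y 0 0)%:~R * xi)|.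
    by rewrite -normrX -normrM; congr `|_|; rewrite /P /yr; ring.
  apply: (@le_lt_trans _ _ (2 * k * `|P| ^+ 3 * L i)).
    apply: le_trans XL; apply: le_trans (ler_normB _ _) _; rewrite !normrM P3.
    by apply: lerD; apply: ler_wpM2l => //; rewrite exprn_ge0.
  have -> : 2 * k * `|P| ^+ 3 * L i = (2 * k * `|P| ^+ 2 * L i) * `|P| by ring.
  apply: (@lt_le_trans _ _ (1 * `|P|)); first by rewrite ltr_pM2r.
  by rewrite mul1r expr2 ler_peMl.
have py : (p %| (y 0 0)%R)%Z.
  have c : coprimez p q by rewrite coprimez_sym.
  by rewrite -(Gauss_dvdzl _ c) (subr0_eq z1) dvdz_mull.
move/dvdzP: py => [m ym].
have z2 : m * q ^+ 3 - y 0 2 * p ^+ 2 = 0.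
  apply: (@int_eq0_lt1 R); apply: le_lt_trans smallP.
  rewrite -(ler_pM2l Pp).
  have -> : `|P| * `|(m * q ^+ 3 - y 0 2 * p ^+ 2)%:~R| =
     `|yr 0 * ((q ^+ 3)%:~R - (p ^+ 3)%:~R * xi ^+ 3) - (p ^+ 3)%:~R * ((y 0 2)%:~R - (y 0 0)%:~R * xi ^+ 3)|.
    by rewrite -normrM; congr `|_|; rewrite /P /yr ym; ring.
  have -> : `|P| * (2 * k * `|P| ^+ 2 * L i) = 2 * k * `|P| ^+ 3 * L i by ring.
  apply: le_trans XL; apply: le_trans (ler_normB _ _) _; rewrite !normrM P3.
  by apply: lerD; apply: ler_wpM2l => //; rewrite exprn_ge0.
have y1 : y 0 1 = m * q by apply: (mulIf pn); rewrite -(subr0_eq z1) ym; ring.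
have := cross_consecutive indep xmin i1; rewrite -/y -/p'; apply/negP/negPn/eqP.
have zz : y 0 2 * p ^+ 2 = m * q ^+ 3 by rewrite (subr0_eq z2).
have hv j : p' 0 j = h * v 0 j by rewrite xv mxE.
apply: row3P; rewrite crossE !hv ?v0 ?v1 ?v2 ?y1 ?ym [RHS]mxE.
- have -> : m * q * (h * q ^+ 3) - y 0 2 * (h * (p ^+ 2 * q))
    = h * q * (m * q ^+ 3 - y 0 2 * p ^+ 2) by ring.
  by rewrite z2 mulr0.
- have -> : y 0 2 * (h * p ^+ 3) - m * p * (h * q ^+ 3)
    = - h * p * (m * q ^+ 3 - y 0 2 * p ^+ 2) by ring.
  by rewrite z2 mulr0.
- by ring.
Qed.
End Minimal.

(** * From the vanishing of D3 or D6 to the size conditions *)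

(** Both polynomials at once, with a common constant that is existentially
    quantified to keep its large numerals out of later computations. *)
Lemma D_zero_bounds : exists2 K0 : int, 0 < K0 & forall p q : 'rV[int]_3,
  let T := formT p q in let F := formF p q in let s := formS p q ^+ 2 * formV p q in
  s != 0 -> 100 * `|s| <= `|T| -> D3 p q = 0 \/ D6 p q = 0 ->
  [/\ F != 0, `|s| * `|T| <= 100 * F ^+ 2 & `|T| <= K0 * `|s| ^+ 3].
Proof.
have [A A0 hA] : exists2 A : int, 0 < A & forall T F s : int,
    s != 0 -> 100 * `|s| <= `|T| ->
    F ^+ 3 - 18 * T * F * s - 135 * s ^+ 2 = 0 ->
    [/\ F != 0, `|s| * `|T| <= F ^+ 2 & `|T| <= A * `|s| ^+ 3].
  exists (135 ^+ 2); [by rewrite exprn_gt0 | exact: D3_zero_bounds].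
have [B B0 hB] : exists2 B : int, 0 < B & forall T F s : int,
    s != 0 -> 100 * `|s| <= `|T| ->
    T * F ^+ 4 + 10 * F ^+ 3 * s - 11 * T ^+ 2 * F ^+ 2 * s
      - 180 * T * F * s ^+ 2 - T ^+ 3 * s ^+ 2 - 675 * s ^+ 3 = 0 ->
    [/\ F != 0, `|s| * `|T| <= 100 * F ^+ 2 & `|T| <= B * `|s| ^+ 3].
  exists (40 * (200 * 16 ^+ 3) ^+ 3); last exact: D6_zero_bounds.
  by rewrite mulr_gt0 // exprn_gt0 // mulr_gt0 // exprn_gt0.
exists (A + B) => [|p q T F s s0 Ts]; first exact: addr_gt0.
have sA : 0 <= A * `|s| ^+ 3 by rewrite mulr_ge0 ?exprn_ge0 // ltW.
have sB : 0 <= B * `|s| ^+ 3 by rewrite mulr_ge0 ?exprn_ge0 // ltW.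
have e := mulrDl A B (`|s| ^+ 3).
case=> D0.
- have [F0 h1 h2] := hA _ _ _ s0 Ts D0.
  apply: And3 => //; last by rewrite e; apply: le_trans h2 _; rewrite lerDl.
  by apply: le_trans h1 _; rewrite ler_peMl // sqr_ge0.
- have [F0 h1 h2] := hB _ _ _ s0 Ts D0.
  by apply: And3 => //; rewrite e; apply: le_trans h2 _; rewrite lerDr.
Qed.

Section Pair.
Variable R : realType.

Lemma intr_ge1 (z : int) : z != 0 -> 1 <= `|z%:~R : R|.
Proof. by move=> z0; rewrite -intr_norm (ler_int R 1) -gtz0_ge1 normr_gt0. Qed.

(** The size conditions for the pair (p, q), with the arithmetic input that
    follows from the vanishing of D3 or D6 as a hypothesis. *)
Lemma D_zero_sizes (K0 : int) (xi k : R) (p q : 'rV[int]_3)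
  (X := supnorm (toR R p)) (Y := supnorm (toR R q)) (L := Lxi xi (toR R p)) (M := Lxi xi (toR R q)) :
  0 < K0 ->
  (let T := formT p q in let F := formF p q in let s := formS p q ^+ 2 * formV p q in
   s != 0 -> 100 * `|s| <= `|T| ->
   [/\ F != 0, `|s| * `|T| <= 100 * F ^+ 2 & `|T| <= K0 * `|s| ^+ 3]) ->
  1 + `|xi| + `|xi| ^+ 3 + 3 * `|xi| ^+ 2 <= k ->
  phi p != 0 -> phi q != 0 -> p != 0 -> q != 0 -> 0 < M -> M <= L -> L < 1 / 2 -> 1 <= X -> X <= Y ->
  100 * (k * k) * (X * (L * L)) <= 1 -> 100 * (k * k) * (X ^+ 3 * M) <= Y ->
  100 * (20 * k ^+ 4 * (X ^+ 3 * Y * L * M)) <= 1 ->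
  600 * (k * k) * (X ^+ 3 * Y * L * M) <= 1 / 4 -> 600 * (k * k) * (X ^+ 4 * M ^+ 2) <= 1 / 4 ->
  Y ^+ 4 <= (2 * k ^+ 2 * X) ^+ 4 *
    (K0%:~R * (100 * (12 * 100 * (k * k) * (Y ^+ 2 * L ^+ 4)) ^+ 2) ^+ 3) /\
  1 <= k ^+ 2 * K0%:~R * (20 * k) ^+ 3 * (X ^+ 11 * Y ^+ 5 * M ^+ 3 * (k * L) ^+ 5).
Proof.
move=> K00 HD hk S0 V0 pn qn M0 ML L12 X1 XY sL sM sP sP4 sQ4.
have L0 : 0 < L := lt_le_trans M0 ML.
have L1 : L <= 1 by apply: ltW; apply: lt_trans L12 _; clear; lra.
have [k1 xik hk' hk3] : [/\ 1 <= k, `|xi| <= k, 1 + `|xi| + `|xi| ^+ 3 <= k & 1 + 3 * `|xi| ^+ 2 <= k].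
  have xi0 := normr_ge0 xi; have xi2 := exprn_ge0 2 xi0; have xi3 := exprn_ge0 3 xi0.
  by move: xi0 xi2 xi3 hk; clear; split; lra.
pose x0 : R := (p 0 0)%:~R; pose d : R := (p 0 1)%:~R - x0 * xi.
pose del : R := (p 0 2)%:~R - x0 * xi ^+ 3 - 3 * xi ^+ 2 * d.
pose y0 : R := (q 0 0)%:~R; pose e : R := (q 0 1)%:~R - y0 * xi.
pose eps : R := (q 0 2)%:~R - y0 * xi ^+ 3 - 3 * xi ^+ 2 * e.
have x0X : `|x0| <= X := supnorm_ge R p 0.
have y0Y : `|y0| <= Y := supnorm_ge R q 0.
have dL : `|d| <= L := Lxi1 xi p.
have eM : `|e| <= M := Lxi1 xi q.
have lin (a b c : R) : 0 < c -> `|a| <= c -> `|b| <= c -> `|a - 3 * xi ^+ 2 * b| <= k * c.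
  move=> c0 ha hb; apply: le_trans (ler_normB _ _) _; rewrite (normrM _ b) (normrM 3) normrX (ger0_norm (ler0n _ 3)).
  have := ler_pM (mulr_ge0 (ler0n _ 3) (exprn_ge0 2 (normr_ge0 xi))) (normr_ge0 b) (lexx _) hb.
  have : (1 + 3 * `|xi| ^+ 2) * c <= k * c by rewrite ler_wpM2r // ltW.
  by move: ha; clear; lra.
have delL : `|del| <= k * L := lin _ _ _ L0 (Lxi2 xi p) dL.
have epsM : `|eps| <= k * M := lin _ _ _ M0 (Lxi2 xi q) eM.
have Xx0 : X <= k * `|x0| := supnorm_le_head hk' pn L12.
have Yy0 : Y <= k * `|y0| := supnorm_le_head hk' qn (le_lt_trans ML L12).
have eS : (formS p q)%:~R = x0 ^+ 2 * del - (3 * xi * x0 * (d * d) + d * d * d).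
  by rewrite /formS /phi /del /d /x0; ring.
have eV : (formV p q)%:~R = y0 ^+ 2 * eps - (3 * xi * y0 * (e * e) + e * e * e).
  by rewrite /formV /phi /eps /e /y0; ring.
have eT : (formT p q)%:~R = 2 * x0 * y0 * del - 3 * xi * y0 * (d * d) + x0 ^+ 2 * eps
    - (6 * xi * x0 * d * e + 3 * d * d * e).
  by rewrite /formT /Phi /del /eps /d /e /x0 /y0; ring.
have eU : (formU p q)%:~R = y0 ^+ 2 * del + 2 * x0 * y0 * eps
    - (3 * xi * (x0 * (e * e) + 2 * y0 * d * e) + 3 * d * (e * e)).
  by rewrite /formU /Phi /del /eps /d /e /x0 /y0; ring.
have es : (formS p q ^+ 2 * formV p q)%:~R = (formS p q)%:~R ^+ 2 * (formV p q)%:~R :> R.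
  by rewrite intrM rmorphXn.
have eF : (formF p q)%:~R = (formT p q)%:~R ^+ 2 - 4 * (formS p q)%:~R * (formU p q)%:~R :> R.
  by rewrite /formF intrB rmorphXn !intrM.
have S1 : 1 <= `|x0 ^+ 2 * del - (3 * xi * x0 * (d * d) + d * d * d)|.
  by rewrite -eS; apply: intr_ge1.
have sT := s_le_T k1 xik X1 XY L0 L1 M0 ML x0X dL delL y0Y eM epsM Xx0 Yy0 S1 sL sM sP.
have s0 : formS p q ^+ 2 * formV p q != 0 by rewrite mulf_neq0 // expf_neq0.
rewrite -eS -eV -eT -es -!intr_norm -[100]/(100%:~R) -intrM ler_int in sT.
have [F0 h1 h2] := HD s0 sT.
have K0R : 0 < K0%:~R :> R by rewrite ltr0z.
have F1 := intr_ge1 F0; rewrite eF eT eS eU in F1.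
have g1 : `|(formS p q ^+ 2 * formV p q)%:~R : R| * `|(formT p q)%:~R| <= 100 * (formF p q)%:~R ^+ 2.
  by rewrite -!intr_norm -rmorphXn -[100]/(100%:~R) -!intrM ler_int.
rewrite es eF eT eS eU eV in g1.
have g2 : `|(formT p q)%:~R : R| <= K0%:~R * `|(formS p q ^+ 2 * formV p q)%:~R| ^+ 3.
  by rewrite -!intr_norm -rmorphXn -!intrM ler_int.
rewrite es eT eS eV in g2.
split.
- exact: (XY2L6_lower k1 xik X1 XY L0 L1 M0 ML x0X dL delL y0Y eM epsM Xx0 Yy0 S1 sL sM K0R F1 g1 g2).
- exact: (X11Y5L5M3_lower k1 xik X1 XY L0 L1 M0 ML x0X dL delL y0Y eM epsM Xx0 Yy0 S1 sL sM K0R g2).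
Qed.

End Pair.

Section Logs.
Variable R : realType.

Definition XY2L6_const (K0 k : R) := 16 * k ^+ 8 * (K0 * (100 * (12 * 100 * (k * k)) ^+ 2) ^+ 3).
Definition X11Y5L5M3_const (K0 k : R) := k ^+ 2 * K0 * (20 * k) ^+ 3 * k ^+ 5.

Lemma le1_ln (a : R) : 0 < a -> ln a <= 0 -> a <= 1.
Proof. by move=> a0; rewrite -ln1 ler_ln ?posrE. Qed.

(** The inequalities between logarithms, translated back to the sizes. *)
Lemma sizes_contradiction (K0 k lam e z t X Y L M : R)
  (x := ln X) (y := ln Y) (l := ln L) (m := ln M) :
  0 < K0 -> 0 < k -> 0 < M -> 0 < L -> 0 < X -> 0 < Y ->
  697 / 1000 < lam -> lam <= 7 / 10 -> 0 < x -> 0 <= e -> x <= z -> z <= y -> y <= t ->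
  l <= e - lam * z -> m <= e - lam * t -> y <= e + z + l + t + m -> lam * x <= e + z + l ->
  40 * (100 * e) <= x -> 3 * e <= - (lam ^+ 2 - 5 * lam + 3) * x ->
  ln (100 * (k * k)) <= e -> ln (100 * (20 * k ^+ 4)) <= e -> ln (4 * (600 * (k * k))) <= e ->
  ln (XY2L6_const K0 k) <= e -> ln (X11Y5L5M3_const K0 k) <= e ->
  [/\ 100 * (k * k) * (X * (L * L)) <= 1, 100 * (k * k) * (X ^+ 3 * M) <= Y,
  100 * (20 * k ^+ 4 * (X ^+ 3 * Y * L * M)) <= 1,
  600 * (k * k) * (X ^+ 3 * Y * L * M) <= 1 / 4 /\ 600 * (k * k) * (X ^+ 4 * M ^+ 2) <= 1 / 4 &
  ~ (Y ^+ 4 <= (2 * k ^+ 2 * X) ^+ 4 *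
    (K0 * (100 * (12 * 100 * (k * k) * (Y ^+ 2 * L ^+ 4)) ^+ 2) ^+ 3) /\
  1 <= k ^+ 2 * K0 * (20 * k) ^+ 3 * (X ^+ 11 * Y ^+ 5 * M ^+ 3 * (k * L) ^+ 5))].
Proof.
move=> K00 k0 M0 L0 X0 Y0 lam_lo lam_hi x0 e0 xz zy yt hl hm hy hx ex eg C1 C2 C3 C4 C5.
have e9 : 9 * e <= x by move: ex e0; clear; lra.
have e40 : 40 * e <= x by move: ex e0; clear; lra.
have w1 := exponent_XL lam_lo lam_hi x0 e0 xz zy yt hl hm hy hx e9.
have w2 := exponent_XM lam_lo lam_hi x0 e0 xz zy yt hl hm hy hx e40.
have w3 := exponent_X4M2 lam_lo lam_hi x0 e0 xz zy yt hl hm hy hx e40.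
have w4 := exponent_X3YLM lam_lo lam_hi x0 e0 xz zy yt hl hm hy hx eg.
have w5 := exponents_contradiction lam_lo lam_hi x0 e0 xz zy yt hl hm hy hx ex.
have kk : 0 < 100 * (k * k) := mulr_gt0 (ltr0Sn R 99) (mulr_gt0 k0 k0).
have k4 : 0 < 100 * (20 * k ^+ 4) by rewrite !mulr_gt0 ?exprn_gt0.
have kq : 0 < 4 * (600 * (k * k)) := mulr_gt0 (ltr0Sn R 3) (mulr_gt0 (ltr0Sn R 599) (mulr_gt0 k0 k0)).
have a0 : 0 < XY2L6_const K0 k by rewrite /XY2L6_const !(mulr_gt0, exprn_gt0).
have b0 : 0 < X11Y5L5M3_const K0 k by rewrite /X11Y5L5M3_const !(mulr_gt0, exprn_gt0).
have lnXn (a : R) n : 0 < a -> ln (a ^+ n) = n%:R * ln a by move=> ?; rewrite lnXn // mulr_natl.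
have P : 0 < X ^+ 3 * Y * L * M by rewrite !mulr_gt0 ?exprn_gt0.
have lP : ln (X ^+ 3 * Y * L * M) = 3 * x + y + l + m.
  rewrite [LHS]lnM ?posrE ?mulr_gt0 ?exprn_gt0 // [ln (_ * L)]lnM ?posrE ?mulr_gt0 ?exprn_gt0 //.
  by rewrite [ln (_ * Y)]lnM ?posrE ?exprn_gt0 // lnXn.
split.
- apply: le1_ln; first exact: mulr_gt0 kk (mulr_gt0 X0 (mulr_gt0 L0 L0)).
  rewrite lnM ?posrE ?kk ?mulr_gt0 // [ln (X * _)]lnM ?posrE ?mulr_gt0 // [ln (L * L)]lnM ?posrE // -/x -/l.
  by move: C1 w1; clear; lra.
- have XM : 0 < X ^+ 3 * M by rewrite mulr_gt0 ?exprn_gt0.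
  rewrite -ler_ln ?posrE ?(mulr_gt0 kk XM) // lnM ?posrE //.
  rewrite [ln (_ * M)]lnM ?posrE ?exprn_gt0 // lnXn // -/x -/m -/y.
  by move: C1 w2; clear; lra.
- rewrite mulrA; apply: le1_ln; first exact: mulr_gt0 k4 P.
  by rewrite lnM ?posrE // lP; move: C2 w4; clear; lra.
- have q1 : 4 * (600 * (k * k)) * (X ^+ 3 * Y * L * M) <= 1.
    apply: le1_ln; first exact: mulr_gt0 kq P.
    by rewrite lnM ?posrE // lP; move: C3 w4; clear; lra.
  have XM : 0 < X ^+ 4 * M ^+ 2 by rewrite !mulr_gt0 ?exprn_gt0.
  have q2 : 4 * (600 * (k * k)) * (X ^+ 4 * M ^+ 2) <= 1.
    apply: le1_ln; first exact: mulr_gt0 kq XM.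
    rewrite lnM ?posrE // [ln (_ * _ ^+ 2)]lnM ?posrE ?exprn_gt0 // !lnXn // -/x -/m.
    by move: C3 w3; clear; lra.
  by move: q1 q2; clear; split; lra.
move=> [al be]; apply: w5.
- have al' : Y ^+ 4 <= XY2L6_const K0 k * (X ^+ 4 * Y ^+ 12 * L ^+ 24).
    by apply: le_trans al _; rewrite le_eqVlt /XY2L6_const; apply/orP; left; apply/eqP; ring.
  have W0 : 0 < X ^+ 4 * Y ^+ 12 * L ^+ 24 by rewrite !mulr_gt0 ?exprn_gt0.
  have Y4 : 0 < Y ^+ 4 by rewrite exprn_gt0.
  move: al'; rewrite -ler_ln ?posrE ?(mulr_gt0 a0 W0) // lnM ?posrE //.
  rewrite [ln (X ^+ 4 * _ * _)]lnM ?posrE ?mulr_gt0 ?exprn_gt0 // [ln (X ^+ 4 * _)]lnM ?posrE ?exprn_gt0 //.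
  by rewrite !lnXn // -/x -/y -/l; move: C4 e0; clear; lra.
- have be' : 1 <= X11Y5L5M3_const K0 k * (X ^+ 11 * Y ^+ 5 * M ^+ 3 * L ^+ 5).
    by apply: le_trans be _; rewrite le_eqVlt /X11Y5L5M3_const; apply/orP; left; apply/eqP; ring.
  move: be'; rewrite -ler_ln ?posrE ?mulr_gt0 ?exprn_gt0 // ln1 lnM ?posrE ?mulr_gt0 ?exprn_gt0 //.
  rewrite [ln (_ * L ^+ 5)]lnM ?posrE ?mulr_gt0 ?exprn_gt0 //.
  rewrite [ln (_ * M ^+ 3)]lnM ?posrE ?mulr_gt0 ?exprn_gt0 // [ln (X ^+ 11 * _)]lnM ?posrE ?exprn_gt0 //.
  by rewrite !lnXn // -/x -/y -/l -/m; move: C5 e0; clear; lra.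
Qed.

End Logs.

(** The approximation hypothesis for lambda implies the one for any smaller
    exponent, so lambda may be taken in the narrow range just above
    (5 - sqrt 13) / 2 for which the numerical estimates are made. *)
Lemma weaken_exponent (R : realType) (lambda : R) : (5 - Num.sqrt 13) / 2 < lambda ->
  exists2 lam, lam <= lambda & [/\ 697 / 1000 < lam, lam <= 7 / 10 & lam ^+ 2 - 5 * lam + 3 < 0].
Proof.
set s := Num.sqrt 13 => hs.
have s0 : 0 <= s by exact: sqrtr_ge0.
have s2 : s ^+ 2 = 13 by rewrite sqr_sqrtr.
have s_lo : 36 / 10 < s.
  rewrite ltNge; apply/negP => h; have := ler_pM s0 s0 h h.
  by rewrite -expr2 s2; clear; lra.
(* 256 / 71 is a convergent of sqrt 13, and (5 - 256 / 71) / 2 > 697 / 1000. *)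
have s_hi : s < 256 / 71.
  rewrite ltNge; apply/negP => h.
  have p0 : 0 <= 256 / 71 :> R by clear; lra.
  have := ler_pM p0 p0 h h.
  by rewrite -[s * s]expr2 s2; clear; lra.
have [lam [l1 l2 l3]] : exists lam, [/\ lam <= lambda, lam <= 7 / 10 & (5 - s) / 2 < lam].
  case: (leP lambda (7 / 10)) => h; first by exists lambda.
  by exists (7 / 10); split; [exact: ltW | | lra].
exists lam => //; split=> //; first by lra.
have -> : lam ^+ 2 - 5 * lam + 3 = (lam - (5 - s) / 2) * (lam - (5 + s) / 2).
  have -> : 3 = (25 - s ^+ 2) / 4 by rewrite s2; lra.
  by field.
by rewrite pmulr_rlt0; lra.
Qed.

(** * Behaviour for large indices *)

Lemma predecessor_in (I : set nat) h0 i : I h0 -> I i -> (h0 < i)%N ->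
  exists2 h, (h0 <= h)%N & successor_in I h i.
Proof.
have [n] := ubnP (i - h0)%N; elim: n h0 => // n IH h0 hn Ih Ii hi.
have [[k [Ik hk ki]]|none] := pselect (exists k, [/\ I k, (h0 < k)%N & (k < i)%N]).
  have [h kh hs] := IH k ltac:(by move: hn hk ki; clear; lia) Ik Ii ki.
  by exists h => //; apply: leq_trans kh; exact: ltnW.
exists h0 => //; split=> // k Ik hk; rewrite leqNgt; apply/negP => ki.
by apply: none; exists k.
Qed.

Lemma abs_sum8 (R : realDomainType) (a1 a2 a3 a4 a5 a6 a7 a8 : R)
  (e := `|a1| + `|a2| + `|a3| + `|a4| + `|a5| + `|a6| + `|a7| + `|a8|) :
  [/\ `|a1| + `|a2| <= e, 0 <= e, [/\ a3 <= e, a4 <= e & a5 <= e] &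
      [/\ a6 <= e, a7 <= e & a8 <= e]].
Proof.
rewrite /e; have p1 := normr_ge0 a1; have p2 := normr_ge0 a2.
have [p3 q3] := (normr_ge0 a3, ler_norm a3); have [p4 q4] := (normr_ge0 a4, ler_norm a4).
have [p5 q5] := (normr_ge0 a5, ler_norm a5); have [p6 q6] := (normr_ge0 a6, ler_norm a6).
have [p7 q7] := (normr_ge0 a7, ler_norm a7); have [p8 q8] := (normr_ge0 a8, ler_norm a8).
by split; [lra | lra | split; lra | split; lra].
Qed.

Lemma ln_prod5 (R : realType) (a b c d f : R) : 0 < a -> 0 < b -> 0 < c -> 0 < d -> 0 < f ->
  ln (a * ((b * c) * (d * f))) = ln a + ln b + ln c + ln d + ln f.
Proof. by move=> *; rewrite !lnM ?posrE ?mulr_gt0 // !addrA. Qed.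

Section Asymptotics.
Variables (R : realType) (xi k lam kap e : R) (x : nat -> 'rV[int]_3) (N : nat).
Hypotheses (indep : lin_indep_rat 1 xi (xi ^+ 3)) (xmin : minimal_points xi x).
Hypotheses (lam_lo : 697 / 1000 < lam) (lam_hi : lam <= 7 / 10).
Hypotheses (k0 : 0 < k) (hk : 1 + `|xi| + `|xi| ^+ 3 <= k) (N0 : (1 <= N)%N).
Let X i : R := supnorm (toR R (x i)).
Let L i : R := Lxi xi (toR R (x i)).
Hypothesis hL : forall i, (N <= i)%N -> ln (L i) <= kap - lam * ln (X i.+1).
Hypothesis large : forall i, (N <= i)%N -> 40 * (100 * e) + 1 <= ln (X i).
Hypotheses (e0 : 0 <= e) (ke : `|kap| + `|ln (8 * k ^+ 2)| <= e) (ke3 : ln (8 * k ^+ 3) <= e).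

Let X_gt0 i : (N <= i)%N -> 0 < X i.
Proof.
move=> Ni; apply: lt_le_trans (minimal_norm_ge xmin i); rewrite ltr0n.
exact: leq_trans N0 Ni.
Qed.

Let L_gt0 i : (N <= i)%N -> 0 < L i.
Proof. by move=> Ni; apply: minimal_L_gt0 => //; exact: leq_trans N0 Ni. Qed.

(** The product in phi_zero_bound tends to 0 because lam > 2/3. *)
Lemma phi_eventually_neq0 i : (N <= i)%N -> phi (x i.+1) != 0.
Proof.
move=> Ni; apply/eqP => /(phi_zero_bound indep xmin hk (leq_trans N0 Ni)).
have NSi : (N <= i.+1)%N by exact: leqW.
have Xp := X_gt0 NSi; have Lp := L_gt0 Ni.
have k3 : 0 < 8 * k ^+ 3 by rewrite mulr_gt0 // exprn_gt0.
rewrite -/(X i.+1) -/(L i) -ler_ln ?posrE ?mulr_gt0 ?exprn_gt0 // ln1.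
rewrite lnM ?posrE ?mulr_gt0 ?exprn_gt0 // [ln (_ * _ ^+ 3)]lnM ?posrE ?exprn_gt0 //.
rewrite !lnXn // -[ln (X i.+1) *+ 2]mulr_natl -[ln (L i) *+ 3]mulr_natl.
have kk : kap <= e.
  by apply: le_trans (ler_norm _) _; apply: le_trans ke; rewrite lerDl.
have h1 := hL Ni; have h2 := large NSi.
have h3 : 697 / 1000 * ln (X i.+1) <= lam * ln (X i.+1).
  by apply: ler_wpM2r (ltW lam_lo); move: h2 e0; lra.
by move: ke3 kk e0 h1 h2 h3; lra.
Qed.

Lemma successor_log i j : (N <= i)%N -> successor_in (indexI x) i j ->
  ln (X j) <= ln (8 * k ^+ 2) + ln (X i.+1) + ln (L i) + ln (X j.+1) + ln (L j).
Proof.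
move=> Ni sij; have [_ _ ij _] := sij.
have Nj : (N <= j)%N by exact: leq_trans Ni (ltnW ij).
have := successor_height indep xmin hk sij; rewrite -/(X j) -/(X i.+1) -/(X j.+1) -/(L i) -/(L j).
have p1 := X_gt0 (leqW Ni); have p2 := L_gt0 Ni; have p3 := X_gt0 (leqW Nj); have p4 := L_gt0 Nj.
have p5 : 0 < 8 * k ^+ 2 by rewrite mulr_gt0 // exprn_gt0.
have p6 : 0 < (X i.+1 * L i) * (X j.+1 * L j) by rewrite !mulr_gt0.
have p7 := mulr_gt0 p5 p6.
have p8 := X_gt0 Nj.
by rewrite -ler_ln ?posrE // ln_prod5.
Qed.

(** Bound the height of the plane spanned by x h and x h.+1 by means of
    L_h << X_(h+1)^(- lam) and X_(h+1) <= X_i in the inequality of successor_log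
    for h and i. *)
Lemma predecessor_log h i : (N <= h)%N -> successor_in (indexI x) h i ->
  lam * ln (X i) <= e + ln (X i.+1) + ln (L i).
Proof.
move=> Nh shi; have [_ _ hi _] := shi.
have h1 := successor_log Nh shi; have h2 := hL Nh.
have h1N : (1 <= h.+1)%N by [].
have Xle : X h.+1 <= X i by exact: (minimal_norm_le xmin h1N hi).
have lnle : ln (X h.+1) <= ln (X i).
  by rewrite ler_ln // posrE X_gt0 // ?leqW // (leq_trans Nh) // ltnW.
have h3 : (1 - lam) * ln (X h.+1) <= (1 - lam) * ln (X i).
  by apply: ler_wpM2l => //; move: lam_hi; lra.
have := ler_norm kap; have := ler_norm (ln (8 * k ^+ 2)).
by move: ke h1 h2 h3; lra.
Qed.

End Asymptotics.

Theorem proposition7p1 (R : realType) (xi lambda c : R)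
    (x : nat -> 'rV[int]_3)
    (xi_indep : lin_indep_rat 1 xi (xi ^+ 3))
    (lambda_gt0 : 0 < lambda) (c_gt0 : 0 < c)
    (approx : \forall X \near +oo, exists y : 'rV[int]_3,
       [/\ y != 0, supnorm (toR R y) <= X &
           Lxi xi (toR R y) <= c * X `^ (- lambda)])
    (x_min : minimal_points xi x)
    (lambda_gt : (5 - Num.sqrt 13) / 2 < lambda) :
  \forall i \near \oo, forall j : nat, successor_in (indexI x) i j ->
    D3 (x i) (x j) != 0 /\ D6 (x i) (x j) != 0.
Proof.
have [lam lam_le [lam_lo lam_hi lam_q]] := weaken_exponent lambda_gt.
have lam0 : 0 <= lam by move: lam_lo; clear; lra.
have [kap [N1 hkap]] := approx_log xi_indep x_min c_gt0 lam0 lam_le approx.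
have [K0 K00 HD] := D_zero_bounds.
pose k : R := 1 + `|xi| + `|xi| ^+ 3 + 3 * `|xi| ^+ 2.
have [k0 hk'] : 0 < k /\ 1 + `|xi| + `|xi| ^+ 3 <= k.
  rewrite /k; have := normr_ge0 xi; have := exprn_ge0 2 (normr_ge0 xi).
  by have := exprn_ge0 3 (normr_ge0 xi); clear; split; lra.
pose X i : R := supnorm (toR R (x i)); pose L i : R := Lxi xi (toR R (x i)).
pose e := `|kap| + `|ln (8 * k ^+ 2)| + `|ln (100 * (k * k))| + `|ln (100 * (20 * k ^+ 4))|
  + `|ln (4 * (600 * (k * k)))| + `|ln (XY2L6_const K0%:~R k)| + `|ln (X11Y5L5M3_const K0%:~R k)|
  + `|ln (8 * k ^+ 3)|.
pose G := - (lam ^+ 2 - 5 * lam + 3).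
have G0 : 0 < G by rewrite oppr_gt0.
have [ea eb [C1 C2 C3] [C4 C5 C6]] := abs_sum8 kap (ln (8 * k ^+ 2)) (ln (100 * (k * k)))
  (ln (100 * (20 * k ^+ 4))) (ln (4 * (600 * (k * k)))) (ln (XY2L6_const K0%:~R k))
  (ln (X11Y5L5M3_const K0%:~R k)) (ln (8 * k ^+ 3)).
rewrite -/e in ea eb C1 C2 C3 C4 C5 C6.
pose B := 40 * (100 * e) + 3 * e / G + 1.
pose N := maxn N1 (Num.bound (expR B)).+1.
have N0 : (1 <= N)%N by rewrite leq_max orbT.
have largeB i : (N <= i)%N -> B <= ln (X i).
  move=> Ni; have XB : expR B <= X i.
    apply: le_trans (minimal_norm_ge x_min i).
    apply: ltW; apply: lt_le_trans (archi_boundP (expR_ge0 B)) _; rewrite ler_nat.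
    by apply: leq_trans Ni; rewrite leq_max leqnSn orbT.
  rewrite -[B]expRK ler_ln ?posrE ?expR_gt0 //; exact: lt_le_trans (expR_gt0 B) XB.
have eG : 0 <= 3 * e / G by rewrite mulr_ge0 ?invr_ge0 ?mulr_ge0 // ltW.
have large i : (N <= i)%N -> 40 * (100 * e) + 1 <= ln (X i).
  by move=> /largeB; apply: le_trans; rewrite /B lerD2r lerDl.
have hL i : (N <= i)%N -> ln (L i) <= kap - lam * ln (X i.+1).
  by move=> Ni; apply: hkap; apply: leq_trans Ni; rewrite leq_max leqnn.
(* Beyond a large element h0 of I every index in I has a large predecessor in I; if there is
   no such h0, then no large index lies in I. *)
have [[h0 [Ih0 Nh0]]|none] := pselect (exists h0, indexI x h0 /\ (N <= h0)%N); last first.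
  exists N => // i /= Ni j [Ii _ _ _]; case: none; exists i; split=> //.
exists h0.+1 => // i /= hi j sij; have [Ii _ ij _] := sij.
have [h h0h shi] := predecessor_in Ih0 Ii hi.
have Nh : (N <= h)%N by exact: leq_trans h0h.
have Ni : (N <= i)%N by apply: leq_trans Nh0 (ltnW hi).
have Nj : (N <= j)%N by apply: leq_trans Ni (ltnW ij).
have i1 : (1 <= i)%N by exact: leq_trans N0 Ni.
have j1 : (1 <= j)%N by exact: leq_trans N0 Nj.
have Xpos n : (N <= n)%N -> 0 < X n.
  move=> Nn; apply: lt_le_trans (minimal_norm_ge x_min n); rewrite ltr0n.
  exact: leq_trans N0 Nn.
have lnX m n : (N <= m)%N -> (m <= n)%N -> ln (X m) <= ln (X n).
  move=> Nm mn; rewrite ler_ln ?posrE ?Xpos ?(leq_trans Nm) //.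
  by apply: (minimal_norm_le x_min) => //; exact: leq_trans N0 Nm.
have phi_i : phi (x i) != 0.
  rewrite -(prednK i1); apply: (phi_eventually_neq0 xi_indep x_min lam_lo k0 hk' N0 hL large eb ea C6).
  by rewrite -ltnS prednK //; exact: leq_ltn_trans Nh0 hi.
have phi_j : phi (x j) != 0.
  rewrite -(prednK j1); apply: (phi_eventually_neq0 xi_indep x_min lam_lo k0 hk' N0 hL large eb ea C6).
  by rewrite -ltnS prednK //; exact: leq_ltn_trans Ni ij.
have kape : kap <= e by apply: le_trans (ler_norm _) _; apply: le_trans ea; rewrite lerDl.
have hl : ln (L i) <= e - lam * ln (X i.+1) by apply: le_trans (hL i Ni) _; rewrite lerD2r.
have hm : ln (L j) <= e - lam * ln (X j.+1) by apply: le_trans (hL j Nj) _; rewrite lerD2r.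
have hy : ln (X j) <= e + ln (X i.+1) + ln (L i) + ln (X j.+1) + ln (L j).
  apply: le_trans (successor_log xi_indep x_min k0 hk' N0 Ni sij) _; rewrite !lerD2r.
  by apply: le_trans (ler_norm _) _; apply: le_trans ea; rewrite lerDr.
have hx := predecessor_log xi_indep x_min lam_hi k0 hk' N0 hL ea Nh shi.
have M0 : 0 < L j by exact: minimal_L_gt0.
have L0 : 0 < L i by exact: minimal_L_gt0.
have x0 : 0 < ln (X i) by have := large i Ni; move: eb; clear; lra.
have ex : 40 * (100 * e) <= ln (X i) by have := large i Ni; move: eb; clear; lra.
have eg : 3 * e <= - (lam ^+ 2 - 5 * lam + 3) * ln (X i).
  rewrite -/G [leRHS]mulrC -ler_pdivrMr //; apply: le_trans (largeB i Ni).
  by rewrite /B; move: eb eG; clear; lra.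
have K0R : 0 < K0%:~R :> R by rewrite ltr0z.
have [s1 s2 s3 [s4 s5] no] := sizes_contradiction K0R k0 M0 L0 (Xpos i Ni) (Xpos j Nj)
  lam_lo lam_hi x0 eb (lnX _ _ Ni (leqnSn i)) (lnX _ _ (leqW Ni) ij) (lnX _ _ Nj (leqnSn j))
  hl hm hy hx ex eg C1 C2 C3 C4 C5.
have key : ~ (D3 (x i) (x j) = 0 \/ D6 (x i) (x j) = 0).
  move=> D0; apply: no.
  apply: (D_zero_sizes K00 _ (lexx _) phi_i phi_j _ _ M0 _ _ _ _ s1 s2 s3 s4 s5).
  - by move=> T F s sn sT; apply: HD.
  - exact: (minimal_neq0 x_min).
  - exact: (minimal_neq0 x_min).
  - exact: (minimal_L_le x_min i1 (ltnW ij)).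
  - exact: (minimal_L_lt_half x_min).
  - by apply: le_trans (minimal_norm_ge x_min i); rewrite ler1n.
  - exact: (minimal_norm_le x_min i1 (ltnW ij)).
by split; apply/eqP => D0; apply: key; [left | right].
Qed.
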